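(* Let $\alpha \in (0,1)$, $k \in \mathbb{N}_0$ and $b,q \in \mathbb{N}$ with $b \leq q$. Then $$\zeta_k(\alpha,b,q)=\frac{H_k(\alpha)}{q}+\frac{(-1)^k}{q}\sum_{a=1}^{q-1}F^{(k)}\!\left(\frac{a}{q},\alpha\right)e^{-2\pi i ab/q},$$ where $$H_k(\alpha)= \int_{1}^{\infty} \{t\}\,\frac{k \log^{k-1} t-\alpha \log^{k} t}{t^{1+\alpha}}\, dt + \frac{(-1)^{k+1}k!}{(1-\alpha)^{k+1}}+ \left\lfloor \frac{1}{k+1} \right\rfloor .$$
   Context: $\{t\}$ denotes the fractional part of $t$ and $\lfloor\cdot\rfloor$ the floor function (so $\lfloor 1/(k+1)\rfloor$ equals $1$ if $k=0$ and $0$ otherwise; for $k=0$ the term $k\log^{k-1}t$ is $0$). For $\alpha\in(0,1)$, $k\in\mathbb{N}_0$ and $r,q\in\mathbb{N}$ with $r\le q$, the shifted Euler constant is $$\zeta_k(\alpha,r,q):=\lim_{x\to\infty}\Big(\sum_{\substack{1\le n\le x\\ n\equiv r \bmod q}}\frac{\log^k n}{n^{\alpha}}-\frac{I_k(x,\alpha)}{q}\Big),\qquad I_k(x,\alpha)=x^{1-\alpha}\sum_{i=0}^{k}(-1)^i\frac{k!}{(k-i)!}\frac{\log^{k-i}x}{(1-\alpha)^{i+1}}$$ (this limit exists). The periodic zeta function is $F(x,s)=\sum_{n\ge1}e^{2\pi i n x}n^{-s}$, defined for $\Re(s)>0$ when $x\notin\mathbb{Z}$ and analytically continued to all of $\mathbb{C}$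 in that case; $F^{(k)}(x,s)$ denotes the $k$-th derivative with respect to $s$. *)

(* Defs.v *)
(* Stdlib's reals with Coquelicot.

   The quantities below that are defined as "the" value of a limit, of a series
   or of a derivative are definite descriptions [iota P], as is Coquelicot's own
   [RInt_gen]: [iota P] is the unique value satisfying [P] when there is one, and
   an unspecified value otherwise.  ([Lim] and [C_derive] are avoided: the former
   only samples its argument along one sequence, the latter only along the real
   direction.) *)
From Stdlib Require Import Reals Arith ZArith.
From Coquelicot Require Import Coquelicot.
Open Scope R_scope.

(* Floor of [x] for [x >= 0], and 0 for [x < 0]. *)
Definition floor_nat (x : R) : nat := Z.to_nat (Int_part x).

Definition I_k (k : nat) (x alpha : R) : R :=
  Rpower x (1 - alpha) *
  sum_n (fun i : nat =>
           (-1) ^ i * (INR (fact k) / INR (fact (k - i))) *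
           ((ln x) ^ (k - i) / (1 - alpha) ^ (i + 1))) k.

Definition progression_sum (k : nat) (alpha : R) (r q : nat) (x : R) : R :=
  sum_n_m (fun n : nat =>
             if Nat.eqb (n mod q) (r mod q)
             then (ln (INR n)) ^ k / Rpower (INR n) alpha
             else 0) 1 (floor_nat x).

Definition shifted_euler_constant (k : nat) (alpha : R) (r q : nat) : R :=
  iota (fun l : R =>
          is_lim (fun x : R => progression_sum k alpha r q x
                               - I_k k x alpha / INR q) p_infty l).

Definition Cexp (z : C) : C :=
  (exp (Re z) * cos (Im z), exp (Re z) * sin (Im z)).

(* The partial sums start at [n = 1], hence the shift [S n]; [n ^ (-s)] is
   [exp (- s ln n)].  For non-integral [x] the series converges exactly on
   [0 < Re s].  Elsewhere the value is unspecified, which is harmless here: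
   derivatives at a point of this open half-plane depend only on the values
   nearby, so they agree with those of the analytic continuation. *)
Definition periodic_zeta_term (x : R) (s : C) (n : nat) : C :=
  (Cexp (2 * PI * Ci * INR (S n) * x) * Cexp (- s * ln (INR (S n))))%C.

Definition periodic_zeta (x : R) (s : C) : C :=
  iota (T := C_CompleteNormedModule)
    (fun l : C => is_series (K := C_AbsRing) (V := C_NormedModule)
                    (periodic_zeta_term x s) l).

Definition complex_derive (f : C -> C) (s : C) : C :=
  iota (T := C_CompleteNormedModule)
    (fun l : C => is_derive (K := C_AbsRing) (V := C_NormedModule) f s l).

Fixpoint complex_derive_n (k : nat) (f : C -> C) : C -> C :=
  match k with
  | O => f
  | S k' => complex_derive (complex_derive_n k' f)
  end.

(* At [k = 0] the term [INR k * (ln t) ^ (k - 1)] is [0 * 1 = 0]. *)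
Definition H_k (k : nat) (alpha : R) : R :=
  RInt_gen (fun t : R =>
              frac_part t *
              ((INR k * (ln t) ^ (k - 1) - alpha * (ln t) ^ k)
               / Rpower t (1 + alpha)))
           (at_point 1) (Rbar_locally p_infty)
  + (-1) ^ (k + 1) * INR (fact k) / (1 - alpha) ^ (k + 1)
  + IZR (Int_part (1 / (INR k + 1))).

(* Main.v *)
(** Write [f(t) = log^k t / t^alpha].  Orthogonality of the [q]-th roots of unity
    splits the sum of [f] over [n = b mod q] into [1/q] times the sums of
    [e(a n / q) f(n)], twisted by [e(- a b / q)], for [0 <= a < q].

    For [a = 0], Euler summation gives the sum up to [I_k] and a convergent
    integral, whence [H_k].  For [1 <= a < q] the partial sums of [e(a n / q)] are
    bounded, so Abel summation makes the Dirichlet series converge for [Re s > 0].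
    Applied to the second-order Taylor remainder of [n^(-s-h)] in [h], the same
    summation bounds the error of termwise differentiation by [O(|h|^2)]; this
    identifies the twisted sum with [(-1)^k F^(k)(a/q, alpha)]. *)
Require Import Defs.
From Stdlib Require Import Reals Arith ZArith Lra Lia.
From Coquelicot Require Import Coquelicot.
Open Scope R_scope.

(** * Complex exponentials and increments of complex-valued functions *)

(** For [0 < Re s <= 1] the series of [F] converges only conditionally, so no absolute majorant
    justifies differentiating it term by term: the cancellation in the coefficients has to survive
    in every estimate. All of them therefore go through one bound, where the coefficients enter only
    by a bound on their partial sums and the weight is a smooth function of [u = ln n]. In this
    variable [n^(-s)] is [exp (- s u)], a derivative in [s] is a factor [- u], and any power of [u]
    is absorbed by giving up a fraction of the exponential decay. The remainder of a difference
    quotient is a weight of the same kind, so complex differentiability comes out directly, with no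
    uniform convergence argument or Cauchy formula. Since the constants in the statement are
    definite descriptions, existence of each limit is established before its value is used. *)

Lemma Cexp_plus (z w : C) : Cexp (z + w) = (Cexp z * Cexp w)%C.
Proof.
  destruct z as [a b], w as [c d].
  unfold Cexp, Cplus, Cmult, Re, Im; simpl.
  rewrite exp_plus, cos_plus, sin_plus.
  f_equal; ring.
Qed.

Lemma Cexp_0 : Cexp 0 = 1%C.
Proof.
  unfold Cexp; simpl.
  rewrite exp_0, cos_0, sin_0; unfold RtoC; f_equal; ring.
Qed.

Lemma Cmod_Cexp (z : C) : Cmod (Cexp z) = exp (Re z).
Proof.
  unfold Cexp, Cmod; simpl.
  replace (_ + _) with (exp (Re z) * exp (Re z)).
  - apply sqrt_square, Rlt_le, exp_pos.
  - pose proof (sin2_cos2 (Im z)) as H; unfold Rsqr in H.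
    replace (exp (Re z) * exp (Re z)) with (exp (Re z) * exp (Re z) * (sin (Im z) * sin (Im z) + cos (Im z) * cos (Im z))) by (rewrite H; ring).
    ring.
Qed.

Lemma Cexp_nat_mult (n : nat) (z : C) : Cexp (INR n * z) = (Cexp z ^ n)%C.
Proof.
  induction n as [|n IH].
  - simpl. rewrite Cmult_0_l. apply Cexp_0.
  - rewrite S_INR, RtoC_plus, Cpow_S, <- IH, <- Cexp_plus. f_equal; ring.
Qed.

(** Componentwise, so that each coordinate is a real function to which [auto_derive] and the mean
    value theorem apply. *)
Definition is_Cderive (g : R -> C) (u : R) (d : C) : Prop :=
  is_derive (fun v => Re (g v)) u (Re d) /\ is_derive (fun v => Im (g v)) u (Im d).

Lemma is_Cderive_eq (g : R -> C) (u : R) (d d' : C) :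
  is_Cderive g u d -> d = d' -> is_Cderive g u d'.
Proof. intros H <-; exact H. Qed.

Lemma is_Cderive_RtoC (f : R -> R) (u d : R) :
  is_derive f u d -> is_Cderive (fun v => RtoC (f v)) u (RtoC d).
Proof.
  intros H; split; simpl.
  - exact H.
  - apply (is_derive_const (V := R_NormedModule)).
Qed.

Lemma is_Cderive_plus (f g : R -> C) (u : R) (df dg : C) :
  is_Cderive f u df -> is_Cderive g u dg ->
  is_Cderive (fun v => (f v + g v)%C) u (df + dg)%C.
Proof.
  intros [H1 H2] [H3 H4]; split; simpl.
  - apply (is_derive_plus (fun v => Re (f v)) (fun v => Re (g v))); assumption.
  - apply (is_derive_plus (fun v => Im (f v)) (fun v => Im (g v))); assumption.
Qed.

Lemma is_Cderive_mult (f g : R -> C) (u : R) (df dg : C) :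
  is_Cderive f u df -> is_Cderive g u dg ->
  is_Cderive (fun v => (f v * g v)%C) u (df * g u + f u * dg)%C.
Proof.
  intros [H1 H2] [H3 H4]; split.
  - evar_last.
    + apply (is_derive_minus (fun v => Re (f v) * Re (g v)) (fun v => Im (f v) * Im (g v)));
        apply (is_derive_mult (K := R_AbsRing)); try eassumption; intros; apply Rmult_comm.
    + unfold minus, plus, opp, mult; simpl; unfold Re, Im; ring.
  - evar_last.
    + apply (is_derive_plus (fun v => Re (f v) * Im (g v)) (fun v => Im (f v) * Re (g v)));
        apply (is_derive_mult (K := R_AbsRing)); try eassumption; intros; apply Rmult_comm.
    + unfold minus, plus, opp, mult; simpl; unfold Re, Im; ring.
Qed.

Lemma is_Cderive_Cexp (z : C) (u : R) :
  is_Cderive (fun v => Cexp (z * v)) u (z * Cexp (z * u))%C.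
Proof.
  destruct z as [a b]; split; unfold Cexp, Cmult, Re, Im; simpl;
    auto_derive; trivial; unfold Rminus; ring.
Qed.

Lemma is_Cderive_const (z : C) (u : R) : is_Cderive (fun _ => z) u 0.
Proof. split; apply (is_derive_const (K := R_AbsRing) (V := R_NormedModule)). Qed.

Lemma is_Cderive_linear (z : C) (u : R) : is_Cderive (fun v => (z * v)%C) u z.
Proof.
  destruct z; split; unfold Re, Im; simpl; auto_derive; trivial; ring.
Qed.

Lemma is_Cderive_Cexp_taylor2 (h : C) (u : R) :
  is_Cderive (fun v => (Cexp (- h * v) - 1 + h * v)%C) u (- h * (Cexp (- h * u) - 1))%C.
Proof.
  eapply is_Cderive_eq.
  - apply (is_Cderive_plus (fun v => (Cexp (- h * v) - 1)%C) (fun v => (h * v)%C)).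
    + apply (is_Cderive_plus (fun v => Cexp (- h * v)) (fun _ => (- (1))%C)).
      * apply is_Cderive_Cexp.
      * apply is_Cderive_const.
    + apply is_Cderive_linear.
  - ring.
Qed.

(** The mean value theorem fails for complex values, so [g] is projected on the direction of
    [d = g b - g a]. The function [Cmod d * phi] minus this projection has a nonnegative derivative,
    and its increment is [Cmod d * (phi b - phi a) - Cmod d ^ 2]. The case [d = 0] is separate
    because [Cmod d] is divided out at the end. *)
Lemma Cmod_increment_le (g dg : R -> C) (phi dphi : R -> R) (a b : R) :
  a <= b ->
  (forall u, a <= u <= b -> is_Cderive g u (dg u)) ->
  (forall u, a <= u <= b -> is_derive phi u (dphi u)) ->
  (forall u, a <= u <= b -> Cmod (dg u) <= dphi u) ->
  Cmod (g b - g a) <= phi b - phi a.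
Proof.
  intros Hab Hg Hphi Hle.
  set (d := (g b - g a)%C).
  destruct (Req_dec (Cmod d) 0) as [Hd|Hd].
  - rewrite Hd.
    destruct (MVT_gen phi a b dphi) as [c [Hc Heq]].
    + intros x Hx; apply Hphi; rewrite Rmin_left, Rmax_right in Hx; lra.
    + intros x Hx; rewrite Rmin_left, Rmax_right in Hx by lra.
      apply derivable_continuous_pt; exists (dphi x); apply is_derive_Reals, Hphi; lra.
    + rewrite Rmin_left, Rmax_right in Hc by lra.
      rewrite Heq. pose proof (Hle c Hc). pose proof (Cmod_ge_0 (dg c)).
      apply Rmult_le_pos; lra.
  - (* the component of [g] in the direction of its total increment *)
    set (psi := fun u => Cmod d * phi u - (Re d * Re (g u) + Im d * Im (g u))).
    set (dpsi := fun u => Cmod d * dphi u - (Re d * Re (dg u) + Im d * Im (dg u))).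
    assert (Hpsi : forall u, a <= u <= b -> is_derive psi u (dpsi u)).
    { intros u Hu. destruct (Hg u Hu) as [H1 H2]. specialize (Hphi u Hu).
      apply (is_derive_minus (fun u => Cmod d * phi u) (fun u => Re d * Re (g u) + Im d * Im (g u))).
      - apply (is_derive_scal phi u (Cmod d)), Hphi.
      - apply (is_derive_plus (fun u => Re d * Re (g u)) (fun u => Im d * Im (g u))).
        + apply (is_derive_scal (fun u => Re (g u))), H1.
        + apply (is_derive_scal (fun u => Im (g u))), H2. }
    assert (Hpos : forall u, a <= u <= b -> 0 <= dpsi u).
    { intros u Hu. unfold dpsi. specialize (Hle u Hu).
      (* Cauchy-Schwarz in the plane: the inner product is the real part of [Cconj d * dg u]. *)
      assert (HCS : Re d * Re (dg u) + Im d * Im (dg u) <= Cmod d * Cmod (dg u)).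
      { rewrite <- (Cmod_conj d), <- Cmod_mult.
        eapply Rle_trans; [|apply re_le_Cmod].
        eapply Rle_trans; [|apply Rle_abs].
        destruct d, (dg u); simpl; lra. }
      pose proof (Rmult_le_compat_l _ _ _ (Cmod_ge_0 d) Hle). lra. }
    destruct (MVT_gen psi a b dpsi) as [c [Hc Heq]].
    + intros x Hx; apply Hpsi; rewrite Rmin_left, Rmax_right in Hx; lra.
    + intros x Hx; rewrite Rmin_left, Rmax_right in Hx by lra.
      apply derivable_continuous_pt; exists (dpsi x); apply is_derive_Reals, Hpsi; lra.
    + rewrite Rmin_left, Rmax_right in Hc by lra.
      assert (Hge : 0 <= psi b - psi a).
      { rewrite Heq. apply Rmult_le_pos; [apply Hpos; lra | lra]. }
      assert (Hsq : Cmod d * Cmod d = Re d * (Re (g b) - Re (g a)) + Im d * (Im (g b) - Im (g a))).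
      { pose proof (Cmod2_alt d) as H. simpl in H. rewrite !Rmult_1_r in H. rewrite H. unfold d; destruct (g b), (g a); simpl; ring. }
      apply Rmult_le_reg_l with (Cmod d).
      * pose proof (Cmod_ge_0 d); lra.
      * unfold psi in Hge. lra.
Qed.

Lemma exp_le_compat (x y : R) : x <= y -> exp x <= exp y.
Proof. intros [H| ->]; [left; now apply exp_increasing | right; reflexivity]. Qed.

(** One factor [u] costs [exp (eta / 2 * u)], because [1 + y <= exp y]; this halving of the rate is
    why the induction quantifies over [eta]. *)
Lemma pow_exp_bound (j : nat) (eta : R) : 0 < eta ->
  exists K, 0 <= K /\ forall u, 0 <= u -> u ^ j <= K * exp (eta * u).
Proof.
  revert eta; induction j as [|j IH]; intros eta Heta.
  - exists 1; split; [lra|]. intros u Hu; simpl.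
    pose proof (exp_ineq1_le (eta * u)). pose proof (Rmult_le_pos eta u). lra.
  - destruct (IH (eta / 2)) as [K [HK Hb]]; [lra|].
    exists (K * (2 / eta)); split.
    { apply Rmult_le_pos; [lra|]. apply Rlt_le, Rdiv_lt_0_compat; lra. }
    intros u Hu; simpl.
    assert (Hu' : u <= 2 / eta * exp (eta / 2 * u)).
    { pose proof (exp_ineq1_le (eta / 2 * u)) as H.
      apply Rle_trans with (2 / eta * (eta / 2 * u)).
      - right; field; lra.
      - apply Rmult_le_compat_l; [apply Rlt_le, Rdiv_lt_0_compat; lra | lra]. }
    replace (eta * u) with (eta / 2 * u + eta / 2 * u) by field.
    rewrite exp_plus.
    replace (K * (2 / eta) * (exp (eta / 2 * u) * exp (eta / 2 * u)))
      with (2 / eta * exp (eta / 2 * u) * (K * exp (eta / 2 * u))) by ring.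
    apply Rmult_le_compat; [assumption | now apply pow_le | assumption | now apply Hb].
Qed.

Lemma Cmod_Cexp_minus_1_le (h : C) (u : R) : 0 <= u ->
  Cmod (Cexp (- h * u) - 1) <= exp (Cmod h * u) - 1.
Proof.
  intros Hu.
  replace (Cexp (- h * u) - 1)%C with (Cexp (- h * u) - Cexp (- h * RtoC 0))%C
    by (rewrite Cmult_0_r, Cexp_0; reflexivity).
  replace (exp (Cmod h * u) - 1) with (exp (Cmod h * u) - exp (Cmod h * 0))
    by (rewrite Rmult_0_r, exp_0; reflexivity).
  apply (Cmod_increment_le (fun v => Cexp (- h * v)) (fun v => - h * Cexp (- h * v))%C
           (fun v => exp (Cmod h * v)) (fun v => Cmod h * exp (Cmod h * v))); auto.
  - intros v _; apply is_Cderive_Cexp.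
  - intros v _; auto_derive; trivial; ring.
  - intros v Hv. rewrite Cmod_mult, Cmod_opp, Cmod_Cexp.
    apply Rmult_le_compat_l; [apply Cmod_ge_0|].
    apply Rle_trans with (exp (Cmod h * v)); [|lra].
    apply exp_le_compat. pose proof (re_le_Cmod h) as H. apply Rabs_le_between in H.
    replace (Re (- h * v)) with (- Re h * v) by (destruct h; simpl; ring).
    apply Rmult_le_compat_r; lra.
Qed.

(** The derivative of the second-order remainder is [- h] times the first-order one, so the previous
    bound integrates once more. At each order the majorant is the corresponding Taylor remainder of
    [exp (Cmod h * u)]. *)
Lemma Cmod_Cexp_taylor2_le (h : C) (u : R) : 0 <= u ->
  Cmod (Cexp (- h * u) - 1 + h * u) <= exp (Cmod h * u) - 1 - Cmod h * u.
Proof.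
  intros Hu.
  set (g := fun v : R => (Cexp (- h * v) - 1 + h * v)%C).
  set (p := fun v => exp (Cmod h * v) - Cmod h * v).
  replace (Cexp (- h * u) - 1 + h * u)%C with (g u - g 0)%C.
  2:{ unfold g; rewrite !Cmult_0_r, Cexp_0; ring. }
  replace (exp (Cmod h * u) - 1 - Cmod h * u) with (p u - p 0).
  2:{ unfold p; rewrite Rmult_0_r, exp_0; ring. }
  apply (Cmod_increment_le g (fun v => - h * (Cexp (- h * v) - 1))%C
           p (fun v => Cmod h * (exp (Cmod h * v) - 1))); auto.
  - intros v _; apply is_Cderive_Cexp_taylor2.
  - intros v _; unfold p; auto_derive; trivial; ring.
  - intros v Hv. rewrite Cmod_mult, Cmod_opp.
    apply Rmult_le_compat_l; [apply Cmod_ge_0|].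
    apply Cmod_Cexp_minus_1_le; lra.
Qed.

Lemma exp_minus_1_le (y : R) : 0 <= y -> exp y - 1 <= y * exp y.
Proof.
  intros Hy. pose proof (exp_ineq1_le (- y)) as H.
  pose proof (exp_pos y) as Hp.
  apply (Rmult_le_compat_r (exp y)) in H; [|lra].
  rewrite <- exp_plus, Rplus_opp_l, exp_0 in H. lra.
Qed.

Lemma exp_taylor2_le (y : R) : 0 <= y -> exp y - 1 - y <= y ^ 2 * exp y.
Proof.
  intros Hy. pose proof (exp_minus_1_le y Hy) as H.
  pose proof (Rmult_le_compat_l y _ _ Hy H). simpl; lra.
Qed.

(** * Abel summation and Dirichlet series *)

(** Goals left by the sum lemmas equate terms in the carrier of an algebraic structure; recasting
    the equation and its operations to [C] lets [ring] recognise them. *)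
Ltac C_ring :=
  match goal with |- @eq _ ?x ?y => change (@eq C x y) end;
  try change plus with Cplus; try change mult with Cmult; ring.

Lemma is_lim_exp_ln (delta : R) : 0 < delta ->
  is_lim (fun x => exp (- (delta * ln x))) p_infty 0.
Proof.
  intros Hd.
  apply (is_lim_comp exp (fun x => - (delta * ln x)) p_infty 0 m_infty).
  - apply is_lim_exp_m.
  - evar_last.
    + apply is_lim_opp, is_lim_scal_l, is_lim_ln_p.
    + simpl. destruct (Rle_dec 0 delta); [|lra].
      destruct (Rle_lt_or_eq_dec 0 delta r); [reflexivity|lra].
  - exists 0; intros; discriminate.
Qed.

(** Summation by parts moves the differences onto [g], and the hypothesis on these differences makes
    the estimate telescope to [phi 0]. *)
Lemma abel_sum_le (c g : nat -> C) (phi : nat -> R) (M : R) :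
  (forall n, Cmod (sum_n c n) <= M) ->
  (forall n, Cmod (g n) <= phi n) ->
  (forall n, Cmod (g n - g (S n)) <= phi n - phi (S n)) ->
  forall n, Cmod (sum_n (fun i => (c i * g i)%C) n) <= M * phi 0%nat.
Proof.
  intros Hc Hg Hd n.
  assert (HM : 0 <= M) by (eapply Rle_trans; [apply Cmod_ge_0 | apply (Hc 0%nat)]).
  (* Once the boundary term is removed, what is left is the sum over [i < n] of [sum_n c i] times
     [g i - g (S i)], which grows by one summand per induction step. *)
  assert (HR : Cmod (sum_n (fun i => (c i * g i)%C) n - sum_n c n * g n) <= M * (phi 0%nat - phi n)).
  { induction n as [|n IH].
    - rewrite !sum_O. replace (c 0%nat * g 0%nat - c 0%nat * g 0%nat)%C with (RtoC 0) by ring.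
      rewrite Cmod_0; lra.
    - rewrite !sum_Sn.
      set (S1 := sum_n (fun i => (c i * g i)%C) n) in *. set (A := sum_n c n) in *.
      change (Cmod ((S1 + c (S n) * g (S n)) - (A + c (S n)) * g (S n)) <= M * (phi 0%nat - phi (S n))).
      replace ((S1 + c (S n) * g (S n)) - (A + c (S n)) * g (S n))%C
        with ((S1 - A * g n) + A * (g n - g (S n)))%C by ring.
      eapply Rle_trans; [apply Cmod_triangle|]. rewrite Cmod_mult.
      pose proof (Rmult_le_compat _ _ _ _ (Cmod_ge_0 A) (Cmod_ge_0 _) (Hc n) (Hd n)).
      lra. }
  set (S1 := sum_n (fun i => (c i * g i)%C) n) in *. set (A := sum_n c n) in *.
  replace S1 with ((S1 - A * g n) + A * g n)%C by ring.
  eapply Rle_trans; [apply Cmod_triangle|]. rewrite Cmod_mult.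
  pose proof (Rmult_le_compat _ _ _ _ (Cmod_ge_0 A) (Cmod_ge_0 _) (Hc n) (Hg n)).
  lra.
Qed.

Lemma sum_n_shift (a : nat -> C) (m n : nat) :
  sum_n (fun i => a (S m + i)%nat) n = (sum_n a (S m + n)%nat - sum_n a m)%C.
Proof.
  induction n as [|n IH].
  - rewrite sum_O, Nat.add_0_r, sum_Sn. C_ring.
  - rewrite sum_Sn, IH, <- plus_n_Sm, sum_Sn. C_ring.
Qed.

(** Cauchy's criterion. A tail is again a sum covered by [abel_sum_le], with shifted coefficients
    whose partial sums are differences of two old ones, hence the factor [2 * M]. *)
Lemma ex_series_abel (c g : nat -> C) (phi : nat -> R) (M : R) :
  (forall n, Cmod (sum_n c n) <= M) ->
  (forall n, Cmod (g n) <= phi n) ->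
  (forall n, Cmod (g n - g (S n)) <= phi n - phi (S n)) ->
  is_lim_seq phi 0 ->
  exists l : C, is_series (K := C_AbsRing) (V := C_NormedModule) (fun n => (c n * g n)%C) l.
Proof.
  intros Hc Hg Hd Hlim.
  assert (HM : 0 <= M) by (eapply Rle_trans; [apply Cmod_ge_0 | apply (Hc 0%nat)]).
  set (a := fun n => (c n * g n)%C).
  assert (Htail : forall m n, (m <= n)%nat -> Cmod (sum_n a n - sum_n a m) <= 2 * M * phi m).
  { intros m n Hmn. destruct (Nat.eq_dec m n) as [->|Hne].
    - unfold Cminus; rewrite Cplus_opp_r, Cmod_0. pose proof (Hg n). pose proof (Cmod_ge_0 (g n)).
      apply Rmult_le_pos; lra.
    - replace n with (S m + (n - S m))%nat by lia.
      rewrite <- sum_n_shift.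
      eapply Rle_trans.
      + apply (abel_sum_le (fun i => c (S m + i)%nat) (fun i => g (S m + i)%nat) (fun i => phi (S m + i)%nat) (2 * M)).
        * intros i. rewrite sum_n_shift. eapply Rle_trans; [apply Cmod_triangle|].
          rewrite Cmod_opp. pose proof (Hc (S m + i)%nat). pose proof (Hc m). lra.
        * intros i; apply Hg.
        * intros i. rewrite <- plus_n_Sm. apply Hd.
      + apply Rmult_le_compat_l; [lra|]. rewrite Nat.add_0_r.
        pose proof (Hd m). pose proof (Cmod_ge_0 (g m - g (S m))). lra. }
  apply (filterlim_locally_cauchy (U := C_CompleteNormedModule) (F := eventually) (sum_n a)).
  intros eps.
  (* [M] may be 0, hence the [+ 1] in the denominator. *)
  assert (Heps : 0 < eps / (2 * M + 1)) by (apply Rdiv_lt_0_compat; [apply cond_pos | lra]).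
  assert (Hsmall : eventually (fun n => 2 * M * phi n < eps)).
  { apply is_lim_seq_spec in Hlim. destruct (Hlim (mkposreal _ Heps)) as [N HN].
    exists N; intros n Hn. specialize (HN n Hn). simpl in HN.
    rewrite Rminus_0_r in HN. apply Rabs_lt_between in HN. destruct HN as [_ HN].
    apply Rle_lt_trans with (2 * M * (eps / (2 * M + 1))).
    - apply Rmult_le_compat_l; lra.
    - pose proof (cond_pos eps). apply Rmult_lt_reg_r with (2 * M + 1); [lra|].
      field_simplify; [|lra]. nra. }
  exists (fun n => 2 * M * phi n < eps); split; [exact Hsmall|].
  assert (Hball : forall u v, (u <= v)%nat -> 2 * M * phi u < eps ->
            ball (M := C_UniformSpace) (sum_n a u) eps (sum_n a v)).
  { intros u v Huv Hu. apply C_NormedModule_mixin_compat1.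
    eapply Rle_lt_trans; [apply (Htail u v Huv) | exact Hu]. }
  intros u v Hu Hv.
  destruct (Nat.le_ge_cases u v).
  - apply Hball; assumption.
  - apply (ball_sym (M := C_UniformSpace)), Hball; assumption.
Qed.

Lemma is_series_Cmod_le (a : nat -> C) (l : C) (B : R) :
  is_series (K := C_AbsRing) (V := C_NormedModule) a l ->
  (forall n, Cmod (sum_n a n) <= B) -> Cmod l <= B.
Proof.
  intros Hl HB.
  apply (is_lim_seq_le (fun n => Cmod (sum_n a n)) (fun _ => B) (Cmod l) B HB).
  - apply (filterlim_comp _ _ _ (sum_n a) Cmod eventually (locally (T := C_NormedModule) l) (locally (Cmod l)) Hl).
    apply (filterlim_norm (K := C_AbsRing) (V := C_NormedModule)).
  - apply is_lim_seq_const.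
Qed.

Lemma ln_ge_0 (t : R) : 1 <= t -> 0 <= ln t.
Proof. intros Ht. rewrite <- ln_1. apply ln_le; lra. Qed.

Lemma ln_INR_S_ge0 (n : nat) : 0 <= ln (INR (S n)).
Proof. apply ln_ge_0. rewrite S_INR. pose proof (pos_INR n); lra. Qed.

Lemma ln_INR_S_incr (n : nat) : ln (INR (S n)) <= ln (INR (S (S n))).
Proof.
  apply ln_le; [apply lt_0_INR; lia | apply le_INR; lia].
Qed.

(* Abel summation in the variable [u = ln n]: the majorant [K exp (- delta u)] telescopes. *)
Lemma dirichlet_series_bound (c : nat -> C) (M : R) (g dg : R -> C) (K delta : R) :
  (forall n, Cmod (sum_n c n) <= M) ->
  0 < delta ->
  (forall u, 0 <= u -> is_Cderive g u (dg u)) ->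
  (forall u, 0 <= u -> Cmod (g u) <= K * exp (- (delta * u))) ->
  (forall u, 0 <= u -> Cmod (dg u) <= K * delta * exp (- (delta * u))) ->
  exists l : C,
    is_series (K := C_AbsRing) (V := C_NormedModule) (fun n => (c n * g (ln (INR (S n))))%C) l
    /\ Cmod l <= M * K.
Proof.
  intros Hc Hdelta Hder Hg Hdg.
  set (phi := fun n => K * exp (- (delta * ln (INR (S n))))).
  assert (H1 : forall n, Cmod (g (ln (INR (S n)))) <= phi n).
  { intros n; apply Hg, ln_INR_S_ge0. }
  assert (H2 : forall n, Cmod (g (ln (INR (S n))) - g (ln (INR (S (S n))))) <= phi n - phi (S n)).
  { intros n. rewrite <- Cmod_opp.
    replace (- (g (ln (INR (S n))) - g (ln (INR (S (S n))))))%C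
      with (g (ln (INR (S (S n)))) - g (ln (INR (S n))))%C by ring.
    pose proof (ln_INR_S_ge0 n) as H0.
    (* [- K * exp (- (delta * u))] is the primitive of the bound on [dg]; its increments are the
       decrements of [phi]. *)
    replace (phi n - phi (S n)) with (- K * exp (- (delta * ln (INR (S (S n))))) - - K * exp (- (delta * ln (INR (S n)))))
      by (unfold phi; ring).
    apply (Cmod_increment_le g dg (fun u => - K * exp (- (delta * u))) (fun u => K * delta * exp (- (delta * u)))).
    - apply ln_INR_S_incr.
    - intros u Hu; apply Hder; lra.
    - intros u Hu; auto_derive; trivial; ring.
    - intros u Hu; apply Hdg; lra. }
  destruct (ex_series_abel c (fun n => g (ln (INR (S n)))) phi M Hc H1 H2) as [l Hl].
  - unfold phi. evar_last.
    + apply (is_lim_seq_scal_l (fun n => exp (- (delta * ln (INR (S n))))) K 0).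
      apply (is_lim_comp_seq (fun x => exp (- (delta * ln x))) (fun n => INR (S n)) p_infty 0).
      * now apply is_lim_exp_ln.
      * exists 0%nat; intros; discriminate.
      * apply (is_lim_seq_incr_1 INR), is_lim_seq_INR.
    + simpl; f_equal; ring.
  - exists l; split; [exact Hl|].
    apply (is_series_Cmod_le _ _ _ Hl).
    intros n. replace (M * K) with (M * phi 0%nat).
    + now apply abel_sum_le.
    + unfold phi. simpl. rewrite ln_1, Rmult_0_r, Ropp_0, exp_0; ring.
Qed.

(** * Termwise differentiation *)

(** The [k]-th derivative in [s] of [exp (- s u)], seen as a function of [u]; at [u = ln n] it is
    the [k]-th [s]-derivative of [n^(-s)]. *)
Definition dterm (k : nat) (s : C) (u : R) : C := (RtoC ((- u) ^ k) * Cexp (- s * u))%C.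

(** The derivative of [dterm] in [u], not in [s]. For [k = 0] the truncated [pred k] is harmless,
    its coefficient being [INR 0]. *)
Definition dterm' (k : nat) (s : C) (u : R) : C :=
  (RtoC (- (INR k * (- u) ^ pred k)) * Cexp (- s * u)
   + RtoC ((- u) ^ k) * (- s * Cexp (- s * u)))%C.

Lemma is_Cderive_dterm (k : nat) (s : C) (u : R) :
  is_Cderive (dterm k s) u (dterm' k s u).
Proof.
  apply (is_Cderive_mult (fun v => RtoC ((- v) ^ k)) (fun v => Cexp (- s * v))).
  - apply (is_Cderive_RtoC (fun v => (- v) ^ k)). auto_derive; trivial; ring.
  - apply is_Cderive_Cexp.
Qed.

Lemma Cmod_Cexp_real (s : C) (u : R) : Cmod (Cexp (- s * u)) = exp (- (Re s * u)).
Proof. rewrite Cmod_Cexp. f_equal. destruct s; simpl; ring. Qed.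

(** Powers of [1 + u] increase with the exponent even for [u < 1], so the single majorant
    [(1 + u) ^ k] serves both [u ^ k] and [u ^ pred k]. *)
Lemma pow_le_pow_add_1 (k : nat) (u : R) : 0 <= u -> u ^ k <= (1 + u) ^ k.
Proof. intros Hu; apply pow_incr; lra. Qed.

Lemma Cmod_dterm_le (k : nat) (s : C) (u : R) : 0 <= u ->
  Cmod (dterm k s u) <= (1 + u) ^ k * exp (- (Re s * u)).
Proof.
  intros Hu. unfold dterm. rewrite Cmod_mult, Cmod_R, Cmod_Cexp_real, <- RPow_abs, Rabs_Ropp, Rabs_pos_eq by assumption.
  apply Rmult_le_compat_r; [apply Rlt_le, exp_pos | now apply pow_le_pow_add_1].
Qed.

Lemma Cmod_dterm'_le (k : nat) (s : C) (u : R) : 0 <= u ->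
  Cmod (dterm' k s u) <= (INR k + Cmod s) * ((1 + u) ^ k * exp (- (Re s * u))).
Proof.
  intros Hu. unfold dterm'.
  eapply Rle_trans; [apply Cmod_triangle|].
  rewrite !Cmod_mult, !Cmod_R, Cmod_opp, Cmod_Cexp_real, Rabs_Ropp, Rabs_mult, <- !RPow_abs,
    Rabs_Ropp, (Rabs_pos_eq u), (Rabs_pos_eq (INR k)) by (assumption || apply pos_INR).
  pose proof (exp_pos (- (Re s * u))) as He.
  assert (H1 : u ^ pred k <= (1 + u) ^ k).
  { apply Rle_trans with ((1 + u) ^ pred k); [now apply pow_le_pow_add_1|].
    apply Rle_pow; [lra | lia]. }
  pose proof (pow_le_pow_add_1 k u Hu) as H2.
  apply Rle_trans with (INR k * (1 + u) ^ k * exp (- (Re s * u)) + (1 + u) ^ k * (Cmod s * exp (- (Re s * u)))).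
  - apply Rplus_le_compat.
    + apply Rmult_le_compat_r; [lra|]. apply Rmult_le_compat_l; [apply pos_INR | assumption].
    + apply Rmult_le_compat_r; [|assumption]. apply Rmult_le_pos; [apply Cmod_ge_0 | lra].
  - right; ring.
Qed.

(* The factor [E] is [1] for the convergence of the series and the second-order
   Taylor remainder of [exp (- h u)] for its differentiation in [s]. *)
Lemma dterm_mult_bound (k : nat) (s : C) : 0 < Re s ->
  exists K, 0 <= K /\
    forall (B : R) (E E' : R -> C), 0 <= B ->
    (forall u, 0 <= u -> Cmod (E u) <= B * ((1 + u) ^ 2 * exp (Re s / 4 * u))) ->
    (forall u, 0 <= u -> Cmod (E' u) <= B * ((1 + u) ^ 2 * exp (Re s / 4 * u))) ->
    forall u, 0 <= u ->
      Cmod (dterm k s u * E u) <= K * B * exp (- (Re s / 2 * u)) /\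
      Cmod (dterm' k s u * E u + dterm k s u * E' u)
        <= K * B * (Re s / 2) * exp (- (Re s / 2 * u)).
Proof.
  intros Hs. set (sigma := Re s) in *.
  (* [dterm] decays at rate [sigma]: one quarter absorbs the polynomial of degree [k + 2], another
     the growth allowed to [E], and [sigma / 2] remains. *)
  destruct (pow_exp_bound (k + 2) (sigma / 4)) as [K0 [HK0 Hpow]]; [lra|].
  set (K1 := K0 * exp (sigma / 4)).
  assert (HK1 : 0 <= K1) by (apply Rmult_le_pos; [lra | apply Rlt_le, exp_pos]).
  (* [INR k + Cmod s] is the cost of [dterm'], the extra 1 that of [dterm k s u * E' u]. *)
  set (A := INR k + Cmod s + 1).
  assert (HA : 0 <= A) by (unfold A; pose proof (pos_INR k); pose proof (Cmod_ge_0 s); lra).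
  assert (HA' : 0 <= A / (sigma / 2)) by (apply Rmult_le_pos; [lra | apply Rlt_le, Rinv_0_lt_compat; lra]).
  (* The summand 1 serves the bound on the product; [A / (sigma / 2)] serves the bound on its
     derivative, where the factor [sigma / 2] is imposed. *)
  exists (K1 * (1 + A / (sigma / 2))). split.
  { apply Rmult_le_pos; lra. }
  intros B E E' HB HE HE' u Hu.
  set (P := (1 + u) ^ k * exp (- (sigma * u))).
  set (Q := B * ((1 + u) ^ 2 * exp (sigma / 4 * u))).
  assert (HP : 0 <= P).
  { apply Rmult_le_pos; [apply pow_le; lra | apply Rlt_le, exp_pos]. }
  assert (HPQ : P * Q <= K1 * B * exp (- (sigma / 2 * u))).
  { replace (P * Q) with (B * ((1 + u) ^ (k + 2) * (exp (- (sigma * u)) * exp (sigma / 4 * u))))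
      by (unfold P, Q; rewrite pow_add; ring).
    rewrite <- exp_plus.
    apply Rle_trans with (B * (K0 * exp (sigma / 4 * (1 + u)) * exp (- (sigma * u) + sigma / 4 * u))).
    - apply Rmult_le_compat_l; [assumption|].
      apply Rmult_le_compat_r; [apply Rlt_le, exp_pos|]. apply Hpow; lra.
    - right. unfold K1.
      replace (- (sigma / 2 * u)) with (sigma / 4 * u + (- (sigma * u) + sigma / 4 * u)) by field.
      replace (sigma / 4 * (1 + u)) with (sigma / 4 + sigma / 4 * u) by ring.
      rewrite !exp_plus; ring. }
  pose proof (exp_pos (- (sigma / 2 * u))) as He.
  specialize (HE u Hu). specialize (HE' u Hu). fold Q in HE, HE'.
  pose proof (Cmod_dterm_le k s u Hu) as HT. pose proof (Cmod_dterm'_le k s u Hu) as HT'.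
  fold sigma P in HT, HT'.
  assert (HKB : 0 <= K1 * B * exp (- (sigma / 2 * u))).
  { apply Rmult_le_pos; [now apply Rmult_le_pos | lra]. }
  split.
  - rewrite Cmod_mult.
    apply Rle_trans with (P * Q).
    + apply Rmult_le_compat; auto using Cmod_ge_0.
    + eapply Rle_trans; [exact HPQ|].
      replace (K1 * (1 + A / (sigma / 2)) * B * exp (- (sigma / 2 * u)))
        with (K1 * B * exp (- (sigma / 2 * u)) + A / (sigma / 2) * (K1 * B * exp (- (sigma / 2 * u)))) by ring.
      pose proof (Rmult_le_pos _ _ HA' HKB). lra.
  - eapply Rle_trans; [apply Cmod_triangle|]. rewrite !Cmod_mult.
    apply Rle_trans with (A * (P * Q)).
    + replace (A * (P * Q)) with ((INR k + Cmod s) * P * Q + P * Q) by (unfold A; ring).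
      apply Rplus_le_compat; apply Rmult_le_compat; auto using Cmod_ge_0.
    + apply Rle_trans with (A * (K1 * B * exp (- (sigma / 2 * u)))).
      * now apply Rmult_le_compat_l.
      * replace (K1 * (1 + A / (sigma / 2)) * B * (sigma / 2) * exp (- (sigma / 2 * u)))
          with (sigma / 2 * (K1 * B * exp (- (sigma / 2 * u))) + A * (K1 * B * exp (- (sigma / 2 * u)))) by (field; lra).
        assert (0 <= sigma / 2 * (K1 * B * exp (- (sigma / 2 * u)))) by (apply Rmult_le_pos; lra).
        lra.
Qed.

(** The Dirichlet series with coefficients [c], differentiated [k] times term by term; index [n]
    stands for the integer [S n]. *)
Definition dirichlet_term (c : nat -> C) (k : nat) (s : C) (n : nat) : C :=
  (c n * dterm k s (ln (INR (S n))))%C.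

Definition dirichlet_sum (c : nat -> C) (k : nat) (s : C) : C :=
  iota (T := C_CompleteNormedModule)
    (fun l : C => is_series (K := C_AbsRing) (V := C_NormedModule) (dirichlet_term c k s) l).

Lemma Cseries_unique (a : nat -> C) (l1 l2 : C) :
  is_series (K := C_AbsRing) (V := C_NormedModule) a l1 ->
  is_series (K := C_AbsRing) (V := C_NormedModule) a l2 -> l1 = l2.
Proof.
  apply (filterlim_locally_unique (K := C_AbsRing) (V := C_NormedModule)).
Qed.

Lemma dirichlet_sum_unique (c : nat -> C) (k : nat) (s l : C) :
  is_series (K := C_AbsRing) (V := C_NormedModule) (dirichlet_term c k s) l ->
  dirichlet_sum c k s = l.
Proof.
  intros Hl. apply (iota_unique (V := C_CompleteNormedModule)).
  - intros y Hy. exact (Cseries_unique _ _ _ Hy Hl).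
  - exact Hl.
Qed.

Lemma dirichlet_sum_correct (c : nat -> C) (M : R) (k : nat) (s : C) :
  (forall n, Cmod (sum_n c n) <= M) -> 0 < Re s ->
  is_series (K := C_AbsRing) (V := C_NormedModule) (dirichlet_term c k s) (dirichlet_sum c k s).
Proof.
  intros Hc Hs.
  destruct (dterm_mult_bound k s Hs) as [K [HK HB]].
  assert (H1 : forall u, 0 <= u -> 1 <= 1 * ((1 + u) ^ 2 * exp (Re s / 4 * u))).
  { intros u Hu. rewrite Rmult_1_l. rewrite <- (Rmult_1_r 1) at 1.
    apply Rmult_le_compat; try lra.
    - apply pow_R1_Rle; lra.
    - rewrite <- exp_0. apply exp_le_compat, Rmult_le_pos; lra. }
  assert (Hb : forall u, 0 <= u ->
      Cmod (dterm k s u * 1) <= K * 1 * exp (- (Re s / 2 * u)) /\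
      Cmod (dterm' k s u * 1 + dterm k s u * 0) <= K * 1 * (Re s / 2) * exp (- (Re s / 2 * u))).
  { apply (HB 1 (fun _ => 1%C) (fun _ => 0%C)); [lra | |]; intros u Hu.
    - rewrite Cmod_1; auto.
    - rewrite Cmod_0. apply Rle_trans with 1; [lra | auto]. }
  destruct (dirichlet_series_bound c M (dterm k s) (dterm' k s) (K * 1) (Re s / 2)) as [l [Hl _]].
  - exact Hc.
  - lra.
  - intros u _; apply is_Cderive_dterm.
  - intros u Hu. destruct (Hb u Hu) as [H _]. rewrite Cmult_1_r in H. exact H.
  - intros u Hu. destruct (Hb u Hu) as [_ H]. rewrite Cmult_1_r, Cmult_0_r, Cplus_0_r in H. exact H.
  - rewrite (dirichlet_sum_unique c k s l Hl). exact Hl.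
Qed.

(** Multiplication by [- u] raises [k] by one, so the linear Taylor term in [h] is exactly the next
    termwise derivative. *)
Lemma dterm_taylor (k : nat) (s h : C) (u : R) :
  (dterm k s u * (Cexp (- h * u) - 1 + h * u) =
   dterm k (s + h) u - dterm k s u - h * dterm (S k) s u)%C.
Proof.
  unfold dterm.
  replace (- (s + h) * u)%C with (- s * u + - h * u)%C by ring.
  rewrite Cexp_plus. simpl pow. rewrite RtoC_mult, RtoC_opp. ring.
Qed.

(** The series of remainders keeps the coefficients [c], so their cancellation still acts, now with
    [B = Cmod h ^ 2]. The restriction on [h] keeps [s + h] in the half-plane and the growth of the
    remainder within [exp (Re s / 4 * u)]. *)
Lemma dirichlet_sum_taylor (c : nat -> C) (M : R) (k : nat) (s : C) :
  (forall n, Cmod (sum_n c n) <= M) -> 0 < Re s ->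
  exists K, 0 <= K /\ forall h : C, Cmod h <= Re s / 4 ->
    Cmod (dirichlet_sum c k (s + h) - dirichlet_sum c k s - h * dirichlet_sum c (S k) s)
      <= K * Cmod h ^ 2.
Proof.
  intros Hc Hs.
  assert (HM : 0 <= M) by (eapply Rle_trans; [apply Cmod_ge_0 | apply (Hc 0%nat)]).
  destruct (dterm_mult_bound k s Hs) as [K [HK HB]].
  exists (M * K); split; [now apply Rmult_le_pos|].
  intros h Hh.
  set (E := fun u : R => (Cexp (- h * u) - 1 + h * u)%C).
  set (E' := fun u : R => (- h * (Cexp (- h * u) - 1))%C).
  pose proof (Cmod_ge_0 h) as Hh0.
  assert (Hexp : forall u, 0 <= u -> exp (Cmod h * u) <= exp (Re s / 4 * u)).
  { intros u Hu. apply exp_le_compat, Rmult_le_compat_r; assumption. }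
  assert (HE : forall u, 0 <= u -> Cmod (E u) <= Cmod h ^ 2 * ((1 + u) ^ 2 * exp (Re s / 4 * u))).
  { intros u Hu. pose proof (Rmult_le_pos _ _ Hh0 Hu) as Hhu.
    eapply Rle_trans; [apply (Cmod_Cexp_taylor2_le h u Hu)|].
    eapply Rle_trans; [apply exp_taylor2_le, Hhu|].
    rewrite Rpow_mult_distr, Rmult_assoc.
    apply Rmult_le_compat_l; [apply pow_le; assumption|].
    apply Rmult_le_compat; [apply pow_le; assumption | apply Rlt_le, exp_pos | | now apply Hexp].
    now apply pow_le_pow_add_1. }
  (* The explicit factor [- h] and the first-order remainder give one power of [Cmod h] each; the
     leftover [u] is below [(1 + u) ^ 2]. *)
  assert (HE' : forall u, 0 <= u -> Cmod (E' u) <= Cmod h ^ 2 * ((1 + u) ^ 2 * exp (Re s / 4 * u))).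
  { intros u Hu. pose proof (Rmult_le_pos _ _ Hh0 Hu) as Hhu.
    unfold E'. rewrite Cmod_mult, Cmod_opp.
    replace (Cmod h ^ 2 * ((1 + u) ^ 2 * exp (Re s / 4 * u)))
      with (Cmod h * (Cmod h * ((1 + u) ^ 2 * exp (Re s / 4 * u)))) by ring.
    apply Rmult_le_compat_l; [assumption|].
    eapply Rle_trans; [apply (Cmod_Cexp_minus_1_le h u Hu)|].
    eapply Rle_trans; [apply exp_minus_1_le, Hhu|].
    rewrite Rmult_assoc. apply Rmult_le_compat_l; [assumption|].
    apply Rmult_le_compat; [assumption | apply Rlt_le, exp_pos | nra | now apply Hexp]. }
  assert (Hb := HB (Cmod h ^ 2) E E' (pow_le _ 2 Hh0) HE HE').
  destruct (dirichlet_series_bound c M (fun u => dterm k s u * E u)%C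
     (fun u => dterm' k s u * E u + dterm k s u * E' u)%C (K * Cmod h ^ 2) (Re s / 2)) as [l [Hl Hle]].
  - exact Hc.
  - lra.
  - intros u _. apply (is_Cderive_mult (dterm k s) E); [apply is_Cderive_dterm|].
    apply is_Cderive_Cexp_taylor2.
  - intros u Hu; apply (Hb u Hu).
  - intros u Hu; apply (Hb u Hu).
  - replace (dirichlet_sum c k (s + h) - dirichlet_sum c k s - h * dirichlet_sum c (S k) s)%C with l.
    + rewrite Rmult_assoc; exact Hle.
    + assert (Hsh : 0 < Re (s + h)).
      { pose proof (re_le_Cmod h) as H. apply Rabs_le_between in H.
        replace (Re (s + h)) with (Re s + Re h) by reflexivity. lra. }
      apply (Cseries_unique _ _ _ Hl).
      apply (is_series_ext (K := C_AbsRing) (V := C_NormedModule)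
        (fun n => plus (plus (dirichlet_term c k (s + h) n) (opp (dirichlet_term c k s n)))
                   (opp (scal h (dirichlet_term c (S k) s n))))).
      * intros n. unfold dirichlet_term.
        set (u := ln (INR (S n))).
        change (c n * dterm k (s + h) u - c n * dterm k s u - h * (c n * dterm (S k) s u)
                = c n * (dterm k s u * E u))%C.
        unfold E. rewrite dterm_taylor. ring.
      * apply (is_series_minus (K := C_AbsRing) (V := C_NormedModule)).
        -- apply (is_series_minus (K := C_AbsRing) (V := C_NormedModule)); apply (dirichlet_sum_correct c M); assumption.
        -- apply (is_series_scal (K := C_AbsRing) (V := C_NormedModule)), (dirichlet_sum_correct c M); assumption.
Qed.

Lemma is_derive_dirichlet_sum (c : nat -> C) (M : R) (k : nat) (s : C) :
  (forall n, Cmod (sum_n c n) <= M) -> 0 < Re s ->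
  is_derive (K := C_AbsRing) (V := C_NormedModule)
    (dirichlet_sum c k) s (dirichlet_sum c (S k) s).
Proof.
  intros Hc Hs.
  destruct (dirichlet_sum_taylor c M k s Hc Hs) as [K [HK Hb]].
  split; [apply (is_linear_scal_l (K := C_AbsRing) (V := C_NormedModule))|].
  intros x Hx. apply (is_filter_lim_locally_unique (K := C_AbsRing) (V := AbsRing_NormedModule C_AbsRing)) in Hx. subst x.
  intros eps.
  (* The first radius is the range of the quadratic estimate, the second makes [K * Cmod (y - s)] at
     most [eps]; [K] may be 0, hence [K + 1]. *)
  assert (Hd : 0 < Rmin (Re s / 4) (eps / (K + 1))).
  { apply Rmin_pos; [lra|]. apply Rdiv_lt_0_compat; [apply cond_pos | lra]. }
  exists (mkposreal _ Hd). intros y Hy.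
  change (Cmod (y - s) < Rmin (Re s / 4) (eps / (K + 1))) in Hy.
  change (Cmod (dirichlet_sum c k y - dirichlet_sum c k s - (y - s) * dirichlet_sum c (S k) s)
    <= eps * Cmod (y - s)).
  pose proof (Rmin_l (Re s / 4) (eps / (K + 1))). pose proof (Rmin_r (Re s / 4) (eps / (K + 1))).
  replace y with (s + (y - s))%C at 1 by ring.
  eapply Rle_trans; [apply Hb; lra|].
  pose proof (Cmod_ge_0 (y - s)).
  replace (K * Cmod (y - s) ^ 2) with (K * Cmod (y - s) * Cmod (y - s)) by ring.
  apply Rmult_le_compat_r; [assumption|].
  apply Rle_trans with ((K + 1) * (eps / (K + 1))).
  - apply Rmult_le_compat; lra.
  - right; field; lra.
Qed.

Lemma complex_derive_unique (f : C -> C) (s l : C) :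
  is_derive (K := C_AbsRing) (V := C_NormedModule) f s l -> complex_derive f s = l.
Proof.
  intros Hl. apply (iota_unique (V := C_CompleteNormedModule)); [|exact Hl].
  intros y Hy.
  apply is_C_derive_unique in Hl. apply is_C_derive_unique in Hy. congruence.
Qed.

(** * Roots of unity and the periodic zeta function *)

Definition ee (y : R) : C := Cexp (2 * PI * Ci * y).

Lemma ee_plus (x y : R) : ee (x + y) = (ee x * ee y)%C.
Proof. unfold ee. rewrite <- Cexp_plus, RtoC_plus. f_equal; ring. Qed.

Lemma ee_INR_mult (n : nat) (y : R) : ee (INR n * y) = (ee y ^ n)%C.
Proof. unfold ee. rewrite <- Cexp_nat_mult, RtoC_mult. f_equal; ring. Qed.

Lemma ee_cos_sin (y : R) : ee y = (cos (2 * PI * y), sin (2 * PI * y)).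
Proof.
  unfold ee, Cexp, Ci, RtoC, Cmult, Re, Im; simpl.
  match goal with |- (exp ?a * cos ?b, _) = _ =>
    replace a with 0 by ring; replace b with (2 * PI * y) by ring end.
  rewrite exp_0. f_equal; ring.
Qed.

Lemma ee_0 : ee 0 = 1%C.
Proof. rewrite ee_cos_sin, Rmult_0_r, cos_0, sin_0. reflexivity. Qed.

Lemma ee_1 : ee 1 = 1%C.
Proof. rewrite ee_cos_sin, Rmult_1_r, cos_2PI, sin_2PI. reflexivity. Qed.

Lemma Cmod_ee (y : R) : Cmod (ee y) = 1.
Proof.
  rewrite ee_cos_sin. unfold Cmod; simpl.
  transitivity (sqrt 1); [f_equal | apply sqrt_1].
  pose proof (sin2_cos2 (2 * PI * y)) as H; unfold Rsqr in H; lra.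
Qed.

(** The real part is [1 - 2 sin^2 (PI y)], and this sine is positive on the open interval. *)
Lemma ee_neq_1 (y : R) : 0 < y < 1 -> ee y <> 1%C.
Proof.
  intros Hy H. rewrite ee_cos_sin in H. apply (f_equal Re) in H. simpl in H.
  replace (2 * PI * y) with (2 * (PI * y)) in H by ring.
  rewrite cos_2a_sin in H.
  assert (0 < sin (PI * y)).
  { pose proof PI_RGT_0. apply sin_gt_0; nra. }
  nra.
Qed.

Lemma geometric_sum (z : C) (n : nat) :
  ((1 - z) * sum_n (fun i => z ^ i) n)%C = (1 - z ^ S n)%C.
Proof.
  induction n as [|n IH].
  - rewrite sum_O. simpl. C_ring.
  - rewrite sum_Sn. change plus with Cplus. rewrite Cmult_plus_distr_l.
    change (AbelianMonoid.sort _) with C in *. rewrite IH. simpl Cpow. C_ring.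
Qed.

(** A geometric sum whose ratio [z] lies on the unit circle and differs from 1: the numerator
    [1 - z ^ S N] has modulus at most 2. *)
Lemma ee_partial_sums_bounded (x : R) : 0 < x < 1 ->
  exists M, forall N, Cmod (sum_n (fun n => ee (INR (S n) * x)) N) <= M.
Proof.
  intros Hx. set (z := ee x).
  assert (Hz : (1 - z)%C <> 0%C).
  { intros H. apply (ee_neq_1 x Hx). fold z.
    replace z with (1 - (1 - z))%C by ring. rewrite H; ring. }
  assert (Hz1 : Cmod z = 1) by apply Cmod_ee.
  exists (2 / Cmod (1 - z)). intros N.
  rewrite (sum_n_ext _ (fun n => mult z (z ^ n)%C)).
  2:{ intros n. rewrite ee_INR_mult. reflexivity. }
  unfold sum_n. rewrite (sum_n_m_mult_l (K := C_Ring) z).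
  change (Cmod (z * sum_n (fun n => z ^ n)%C N) <= 2 / Cmod (1 - z)).
  rewrite Cmod_mult, Hz1, Rmult_1_l.
  apply Rmult_le_reg_l with (Cmod (1 - z)); [now apply Cmod_gt_0|].
  rewrite <- Cmod_mult, geometric_sum.
  replace (Cmod (1 - z) * (2 / Cmod (1 - z))) with 2.
  2:{ field. apply Rgt_not_eq. now apply Cmod_gt_0. }
  eapply Rle_trans; [apply Cmod_triangle|].
  rewrite Cmod_opp, Cmod_1, Cmod_pow, Hz1, pow1. lra.
Qed.

Lemma periodic_zeta_term_dirichlet (x : R) (s : C) (n : nat) :
  periodic_zeta_term x s n = dirichlet_term (fun m => ee (INR (S m) * x)) 0 s n.
Proof.
  unfold periodic_zeta_term, dirichlet_term, dterm, ee. simpl pow.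
  rewrite Cmult_1_l, RtoC_mult. do 2 f_equal. ring.
Qed.

(** Each step differentiates a function known to equal [dirichlet_sum] only on the half-plane. Hence
    the induction quantifies over [s] and extensionality is used locally, on the ball of radius
    [Re s] around [s], which stays in the half-plane. *)
Lemma complex_derive_n_periodic_zeta (x : R) (k : nat) (s : C) :
  0 < x < 1 -> 0 < Re s ->
  complex_derive_n k (periodic_zeta x) s = dirichlet_sum (fun m => ee (INR (S m) * x)) k s.
Proof.
  intros Hx. destruct (ee_partial_sums_bounded x Hx) as [M HM].
  revert s; induction k as [|k IH]; intros s Hs; simpl.
  - apply (iota_unique (V := C_CompleteNormedModule)).
    + intros y Hy. symmetry. apply dirichlet_sum_unique.
      revert Hy. apply is_series_ext. apply periodic_zeta_term_dirichlet.
    + apply (is_series_ext (dirichlet_term (fun m => ee (INR (S m) * x)) 0 s)).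
      * intros n; symmetry; apply periodic_zeta_term_dirichlet.
      * now apply (dirichlet_sum_correct _ M).
  - apply complex_derive_unique.
    apply (is_derive_ext_loc (K := C_AbsRing) (V := C_NormedModule) (dirichlet_sum (fun m => ee (INR (S m) * x)) k)).
    + exists (mkposreal _ Hs). intros y Hy. symmetry. apply IH.
      change (Cmod (y - s) < Re s) in Hy.
      pose proof (re_le_Cmod (y - s)) as H. apply Rabs_le_between in H.
      replace (Re (y - s)) with (Re y - Re s) in H by reflexivity. lra.
    + now apply (is_derive_dirichlet_sum _ M).
Qed.

(** The summands are the powers of [w], the value of [ee] at [(n - b) / q]. If [w = 1] they are [q]
    ones; otherwise [w ^ q = 1] makes the geometric sum vanish. *)
Lemma roots_of_unity_sum (n b q : nat) : (1 <= q)%nat -> (b <= q)%nat ->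
  sum_n (fun a => ee (INR a * (INR n / INR q)) * ee (- (INR a * (INR b / INR q))))%C (q - 1)
  = RtoC (if Nat.eqb (n mod q) (b mod q) then INR q else 0).
Proof.
  intros Hq Hb.
  assert (Hq0 : INR q <> 0) by (apply not_0_INR; lia).
  (* Adding [q] keeps [n - b] in the natural numbers without changing [w], as [ee] has period 1.
     Reduction modulo [q] brings the argument of [ee] into [[0, 1)], where [ee_neq_1] applies unless
     [r = 0]. *)
  set (m := (n + (q - b))%nat). set (r := (m mod q)%nat). set (w := ee (INR r / INR q)).
  assert (Hr : (r < q)%nat) by (apply Nat.mod_upper_bound; lia).
  assert (Hm : m = (q * (m / q) + r)%nat) by (apply Nat.div_mod; lia).
  assert (Hstep : (ee (INR n / INR q) * ee (- (INR b / INR q)))%C = w).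
  { rewrite <- ee_plus.
    replace (INR n / INR q + - (INR b / INR q)) with (INR m / INR q + - 1).
    2:{ unfold m. rewrite plus_INR, minus_INR by assumption. field; assumption. }
    rewrite ee_plus. rewrite Hm at 1. rewrite plus_INR, mult_INR.
    replace ((INR q * INR (m / q) + INR r) / INR q) with (INR (m / q) * 1 + INR r / INR q) by (field; assumption).
    rewrite ee_plus, ee_INR_mult, ee_1, Cpow_1_l.
    assert (H : ee (-1) = 1%C).
    { rewrite <- (Cmult_1_r (ee (-1))), <- ee_1 at 1. rewrite <- ee_plus.
      replace (-1 + 1) with 0 by ring. apply ee_0. }
    replace (- (1)) with (-1) by ring. rewrite H. unfold w. ring. }
  rewrite (sum_n_ext _ (fun a => w ^ a)%C).
  2:{ intros a. rewrite <- Hstep, Cpow_mult_l, <- !ee_INR_mult.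
      do 2 f_equal. ring. }
  assert (Hmod : (r = 0)%nat <-> (n mod q = b mod q)%nat).
  { assert (Hn : n = (q * (n / q) + n mod q)%nat) by (apply Nat.div_mod; lia).
    assert (Hbb : b = (q * (b / q) + b mod q)%nat) by (apply Nat.div_mod; lia).
    assert (Hnr : (n mod q < q)%nat) by (apply Nat.mod_upper_bound; lia).
    assert (Hbr : (b mod q < q)%nat) by (apply Nat.mod_upper_bound; lia).
    unfold m in *. set (t := ((n + (q - b)) / q)%nat) in *. clearbody t r.
    set (A := (n / q)%nat) in *. set (B := (b / q)%nat) in *.
    set (x := (n mod q)%nat) in *. set (y := (b mod q)%nat) in *. clearbody A B x y.
    (* With [x], [y], [r] all in [[0, q)], either side of the equivalence forces the cofactor [d] of
       [q] to be 0, and then [r = x - y]. *)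
    assert (Hz : (Z.of_nat x - Z.of_nat y - Z.of_nat r
                  = Z.of_nat q * (Z.of_nat t + Z.of_nat B - Z.of_nat A - 1))%Z) by nia.
    set (d := (Z.of_nat t + Z.of_nat B - Z.of_nat A - 1)%Z) in *. clearbody d.
    assert (Hd : (d <= -1 \/ d = 0 \/ 1 <= d)%Z) by lia.
    split; intros H; destruct Hd as [Hd|[Hd|Hd]]; subst; nia. }
  destruct (Nat.eqb_spec (n mod q) (b mod q)) as [He|He].
  - assert (Hw : w = 1%C).
    { unfold w. replace r with 0%nat by (symmetry; now apply Hmod).
      simpl. unfold Rdiv. rewrite Rmult_0_l. apply ee_0. }
    rewrite Hw. replace (INR q) with (INR (S (q - 1))) by (f_equal; lia).
    induction (q - 1)%nat as [|p IH].
    + rewrite sum_O. reflexivity.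
    + rewrite sum_Sn, IH, Cpow_1_l, (S_INR (S p)), RtoC_plus. reflexivity.
  - assert (Hw : (1 - w)%C <> 0%C).
    { intros H. apply (ee_neq_1 (INR r / INR q)).
      - assert (r <> 0)%nat by (intros ?; now apply He, Hmod).
        assert (0 < INR q) by (apply lt_0_INR; lia).
        split.
        + apply Rdiv_lt_0_compat; [apply lt_0_INR; lia | assumption].
        + apply Rmult_lt_reg_r with (INR q); [assumption|].
          replace (INR r / INR q * INR q) with (INR r) by (field; assumption).
          rewrite Rmult_1_l. now apply lt_INR.
      - fold w. replace w with (1 - (1 - w))%C by ring. rewrite H; ring. }
    pose proof (geometric_sum w (q - 1)) as H.
    replace (S (q - 1)) with q in H by lia.
    replace (w ^ q)%C with (RtoC 1) in H.
    2:{ unfold w. rewrite <- ee_INR_mult.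
        replace (INR q * (INR r / INR q)) with (INR r * 1) by (field; assumption).
        rewrite ee_INR_mult, ee_1, Cpow_1_l. reflexivity. }
    apply (f_equal (Cmult (/ (1 - w)))) in H.
    rewrite Cmult_assoc, Cinv_l, Cmult_1_l in H by assumption.
    rewrite H. C_ring.
Qed.

(** * Euler summation *)

Definition fpow (k : nat) (alpha t : R) : R := (ln t) ^ k / Rpower t alpha.

(** Shaped like the integrand of [H_k], so that the two are convertible. For [k = 0] the truncated
    [k - 1] is multiplied by [INR 0]. *)
Definition fpow' (k : nat) (alpha t : R) : R :=
  (INR k * (ln t) ^ (k - 1) - alpha * (ln t) ^ k) / Rpower t (1 + alpha).

Lemma is_derive_fpow (k : nat) (alpha t : R) : 0 < t ->
  is_derive (fpow k alpha) t (fpow' k alpha t).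
Proof.
  intros Ht. unfold fpow, fpow', Rpower.
  pose proof (exp_pos (alpha * ln t)).
  auto_derive.
  - repeat split; lra.
  - replace ((1 + alpha) * ln t) with (ln t + alpha * ln t) by ring.
    rewrite exp_plus, exp_ln by assumption.
    replace (pred k) with (k - 1)%nat by lia.
    field. lra.
Qed.

Lemma fpow_bound (k : nat) (alpha : R) : 0 < alpha ->
  exists K, 0 <= K /\ forall t, 1 <= t -> 0 <= fpow k alpha t <= K * exp (- (alpha / 2 * ln t)).
Proof.
  intros Ha. destruct (pow_exp_bound k (alpha / 2)) as [K [HK Hb]]; [lra|].
  exists K; split; [assumption|]. intros t Ht.
  pose proof (ln_ge_0 t Ht) as Hu. unfold fpow, Rpower, Rdiv. rewrite <- exp_Ropp. split.
  - apply Rmult_le_pos; [now apply pow_le | apply Rlt_le, exp_pos].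
  - replace (- (alpha * / 2 * ln t)) with (alpha / 2 * ln t + - (alpha * ln t)) by field.
    rewrite exp_plus, <- Rmult_assoc.
    apply Rmult_le_compat_r; [apply Rlt_le, exp_pos | now apply Hb].
Qed.

(** Half of [alpha] pays for the logarithms; the remaining exponent [1 + alpha / 2] is still
    integrable at infinity. *)
Lemma fpow'_bound (k : nat) (alpha : R) : 0 < alpha ->
  exists K, 0 <= K /\ forall t, 1 <= t -> Rabs (fpow' k alpha t) <= K * exp (- ((1 + alpha / 2) * ln t)).
Proof.
  intros Ha.
  destruct (pow_exp_bound k (alpha / 2)) as [K [HK Hb]]; [lra|].
  destruct (pow_exp_bound (k - 1) (alpha / 2)) as [K1 [HK1 Hb1]]; [lra|].
  exists (INR k * K1 + alpha * K). split.
  { pose proof (Rmult_le_pos _ _ (pos_INR k) HK1). pose proof (Rmult_le_pos alpha K). lra. }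
  intros t Ht. pose proof (ln_ge_0 t Ht) as Hu.
  unfold fpow', Rpower, Rdiv. rewrite <- exp_Ropp, Rabs_mult, (Rabs_pos_eq (exp _)) by apply Rlt_le, exp_pos.
  replace (- ((1 + alpha * / 2) * ln t)) with (alpha / 2 * ln t + - ((1 + alpha) * ln t)) by field.
  rewrite exp_plus, <- Rmult_assoc.
  apply Rmult_le_compat_r; [apply Rlt_le, exp_pos|].
  pose proof (Rmult_le_compat_l _ _ _ (pos_INR k) (Hb1 _ Hu)) as H1.
  assert (H2 := Rmult_le_compat_l alpha _ _ (Rlt_le _ _ Ha) (Hb _ Hu)).
  assert (H3 : 0 <= INR k * ln t ^ (k - 1)) by (apply Rmult_le_pos; [apply pos_INR | now apply pow_le]).
  assert (H4 : 0 <= alpha * ln t ^ k) by (apply Rmult_le_pos; [lra | now apply pow_le]).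
  apply Rabs_le. lra.
Qed.

Lemma I_k_0 (x alpha : R) : alpha < 1 -> I_k 0 x alpha = Rpower x (1 - alpha) / (1 - alpha).
Proof.
  intros Ha. unfold I_k. rewrite sum_O. simpl. field. lra.
Qed.

(** Integration by parts of [log^(k+1) t / t^alpha], read off the finite sum: the summand of index 0
    is the boundary term, and the others are a shifted multiple of [I_k k]. *)
Lemma I_k_succ (k : nat) (x alpha : R) : alpha < 1 ->
  I_k (S k) x alpha =
  Rpower x (1 - alpha) * (ln x) ^ S k / (1 - alpha) - INR (S k) / (1 - alpha) * I_k k x alpha.
Proof.
  intros Ha. unfold I_k, sum_n.
  rewrite sum_Sn_m by lia. rewrite <- sum_n_m_S.
  rewrite (sum_n_m_ext _ (fun i => mult (- (INR (S k) / (1 - alpha)))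
     ((-1) ^ i * (INR (fact k) / INR (fact (k - i))) * (ln x ^ (k - i) / (1 - alpha) ^ (i + 1))))).
  - rewrite (sum_n_m_mult_l (K := R_Ring)).
    set (s := sum_n_m _ 0 k). rewrite Nat.sub_0_r.
    change plus with Rplus. change mult with Rmult.
    replace (0 + 1)%nat with 1%nat by reflexivity.
    rewrite pow_O, pow_1. field. split; [lra | apply INR_fact_neq_0].
  - intros i. change mult with Rmult.
    replace (S k - S i)%nat with (k - i)%nat by lia.
    replace (S i + 1)%nat with (S (i + 1)) by lia.
    rewrite fact_simpl, mult_INR. simpl pow.
    match goal with |- @eq _ ?x ?y => change (@eq R x y) end.
    field. repeat split; first [apply INR_fact_neq_0 | lra | apply pow_nonzero; lra].
Qed.

(** This is why [I_k] is the main term: it is a primitive of the summand. In the recurrence, the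
    derivative of the logarithmic power cancels against that of the [I_k k] part. *)
Lemma is_derive_I_k (k : nat) (alpha x : R) : alpha < 1 -> 0 < x ->
  is_derive (fun y => I_k k y alpha) x (fpow k alpha x).
Proof.
  intros Ha Hx. pose proof (exp_pos (alpha * ln x)).
  assert (Hpow : exp ((1 - alpha) * ln x) = x / exp (alpha * ln x)).
  { replace ((1 - alpha) * ln x) with (ln x + - (alpha * ln x)) by ring.
    rewrite exp_plus, exp_Ropp, exp_ln by assumption. reflexivity. }
  induction k as [|k IH].
  - apply (is_derive_ext (fun y => Rpower y (1 - alpha) / (1 - alpha))).
    + intros y; symmetry; now apply I_k_0.
    + unfold fpow, Rpower. auto_derive; [repeat split; lra|].
      rewrite Hpow. simpl. field. lra.
  - apply (is_derive_ext (fun y => minus (Rpower y (1 - alpha) * (ln y) ^ S k / (1 - alpha))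
       (INR (S k) / (1 - alpha) * I_k k y alpha))).
    + intros y; symmetry; now apply I_k_succ.
    + evar_last.
      * apply (is_derive_minus (K := R_AbsRing) (V := R_NormedModule)).
        -- unfold Rpower. auto_derive; [repeat split; lra | reflexivity].
        -- apply (is_derive_scal (fun y => I_k k y alpha)), IH.
      * change minus with Rminus. simpl pred. rewrite Hpow. unfold fpow, Rpower.
        change (ln x ^ S k) with (ln x * ln x ^ k).
        change (match k with 0%nat => 1 | S _ => INR k + 1 end) with (INR (S k)).
        field. lra.
Qed.

(** With opposite sign this is the middle term of [H_k], the lower endpoint of the primitive. *)
Lemma I_k_at_1 (k : nat) (alpha : R) : alpha < 1 ->
  I_k k 1 alpha = (-1) ^ k * INR (fact k) / (1 - alpha) ^ (k + 1).
Proof.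
  intros Ha. induction k as [|k IH].
  - rewrite I_k_0 by assumption. unfold Rpower. rewrite ln_1, Rmult_0_r, exp_0. simpl. field. lra.
  - rewrite I_k_succ, IH, ln_1, fact_simpl, mult_INR by assumption.
    replace (S k + 1)%nat with (S (k + 1)) by lia. simpl pow.
    field. split; first [lra | apply pow_nonzero; lra].
Qed.

(** Both sides are [0 ^ k]: the floor in [H_k] is the summand at the integer 1. *)
Lemma fpow_at_1 (k : nat) (alpha : R) : fpow k alpha 1 = IZR (Int_part (1 / (INR k + 1))).
Proof.
  unfold fpow, Rpower. rewrite ln_1, Rmult_0_r, exp_0.
  pose proof (pos_INR k) as Hk.
  destruct k as [|k].
  - replace (Int_part (1 / (INR 0 + 1))) with 1%Z; [simpl; field|].
    apply Int_part_spec. simpl. lra.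
  - replace (Int_part (1 / (INR (S k) + 1))) with 0%Z.
    + simpl. unfold Rdiv; ring.
    + apply Int_part_spec.
      assert (0 < 1 / (INR (S k) + 1)) by (apply Rdiv_lt_0_compat; lra).
      assert (1 / (INR (S k) + 1) < 1).
      { apply Rmult_lt_reg_r with (INR (S k) + 1); [lra|].
        replace (1 / (INR (S k) + 1) * (INR (S k) + 1)) with 1 by (field; lra).
        assert (0 < INR (S k)) by (apply lt_0_INR; lia). lra. }
      lra.
Qed.

(** Between consecutive integers [frac_part t] is [t - N], and integration by parts gives the
    primitive [(t - N) * fpow k alpha t - I_k k t alpha]. The jump at [N + 1] is harmless, since the
    integrands have to agree only on the open interval. *)
Lemma is_RInt_frac_part_piece (k : nat) (alpha x : R) (n : nat) : alpha < 1 ->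
  INR (S n) <= x <= INR (S n) + 1 ->
  is_RInt (fun t => frac_part t * fpow' k alpha t) (INR (S n)) x
    ((x - INR (S n)) * fpow k alpha x - I_k k x alpha + I_k k (INR (S n)) alpha).
Proof.
  intros Ha Hx. set (N := INR (S n)) in *.
  assert (HN : 0 < N) by (apply lt_0_INR; lia).
  apply (is_RInt_ext (fun t => (t - N) * fpow' k alpha t)).
  { intros t Ht. rewrite Rmin_left, Rmax_right in Ht by lra.
    f_equal. unfold frac_part.
    replace (Int_part t) with (Z.of_nat (S n)).
    - rewrite <- INR_IZR_INZ. reflexivity.
    - apply Int_part_spec. rewrite <- INR_IZR_INZ. fold N. lra. }
  evar_last.
  - apply (is_RInt_derive (fun t => (t - N) * fpow k alpha t - I_k k t alpha)).
    + intros t Ht. rewrite Rmin_left, Rmax_right in Ht by lra.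
      evar_last.
      * apply (is_derive_minus (fun t => (t - N) * fpow k alpha t) (fun t => I_k k t alpha)).
        -- apply (is_derive_mult (fun t => t - N) (fpow k alpha)).
           ++ auto_derive; reflexivity.
           ++ apply is_derive_fpow; lra.
           ++ intros; apply Rmult_comm.
        -- apply is_derive_I_k; lra.
      * unfold minus, plus, opp, mult; simpl. ring.
    + intros t Ht. rewrite Rmin_left, Rmax_right in Ht by lra.
      apply (ex_derive_continuous (K := R_AbsRing) (V := R_NormedModule)). unfold fpow', Rpower. auto_derive.
      repeat split; try lra; apply Rgt_not_eq, exp_pos.
  - unfold minus, plus, opp; simpl. fold N. ring.
Qed.

Definition power_sum (k : nat) (alpha : R) (n : nat) : R :=
  sum_n_m (fun i => fpow k alpha (INR i)) 1 n.

Lemma power_sum_succ (k : nat) (alpha : R) (n : nat) :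
  power_sum k alpha (S n) = power_sum k alpha n + fpow k alpha (INR (S n)).
Proof. unfold power_sum. rewrite sum_n_Sm by lia. reflexivity. Qed.

(* Euler's summation formula, solved for the integral *)
Definition euler_integral (k : nat) (alpha : R) (n : nat) (x : R) : R :=
  power_sum k alpha n - fpow k alpha 1 + (x - INR n) * fpow k alpha x - I_k k x alpha + I_k k 1 alpha.

(** The range of [x] is closed on the right so that the pieces meet: at the next integer the factor
    [x - INR (S n)] is 1, and the boundary term becomes the next summand of [power_sum]. *)
Lemma is_RInt_euler (k : nat) (alpha : R) (n : nat) (x : R) : alpha < 1 ->
  INR (S n) <= x <= INR (S n) + 1 ->
  is_RInt (fun t => frac_part t * fpow' k alpha t) 1 x (euler_integral k alpha (S n) x).
Proof.
  intros Ha. revert x. induction n as [|n IH]; intros x Hx.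
  - evar_last; [apply (is_RInt_frac_part_piece k alpha x 0 Ha Hx)|].
    unfold euler_integral. rewrite power_sum_succ. unfold power_sum.
    rewrite sum_n_m_zero by lia. change (INR 1) with 1. change zero with 0. ring.
  - evar_last.
    + apply (is_RInt_Chasles (V := R_NormedModule)) with (INR (S (S n))).
      * apply IH. rewrite (S_INR (S n)). lra.
      * apply (is_RInt_frac_part_piece k alpha x (S n) Ha Hx).
    + unfold euler_integral. rewrite (power_sum_succ _ _ (S n)).
      change plus with Rplus. rewrite (S_INR (S n)). ring.
Qed.

Lemma floor_nat_spec (x : R) : 1 <= x ->
  exists n, floor_nat x = S n /\ INR (S n) <= x <= INR (S n) + 1.
Proof.
  intros Hx. destruct (base_Int_part x) as [H1 H2].
  assert (Hz : (1 <= Int_part x)%Z).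
  { assert (0 < IZR (Int_part x)) by lra. apply lt_IZR in H. lia. }
  exists (pred (floor_nat x)). unfold floor_nat.
  assert (E : S (pred (Z.to_nat (Int_part x))) = Z.to_nat (Int_part x)) by lia.
  split; [congruence|]. rewrite E, INR_IZR_INZ, Z2Nat.id by lia. lra.
Qed.

Lemma euler_integral_lim (k : nat) (alpha : R) : 0 < alpha < 1 ->
  exists L : R, is_lim (fun x => euler_integral k alpha (floor_nat x) x) p_infty L.
Proof.
  intros Ha. set (V := fun x => euler_integral k alpha (floor_nat x) x).
  assert (HV : forall x, 1 <= x -> is_RInt (fun t => frac_part t * fpow' k alpha t) 1 x (V x)).
  { intros x Hx. destruct (floor_nat_spec x Hx) as [n [Hn Hb]]. unfold V. rewrite Hn.
    apply is_RInt_euler; [lra | assumption]. }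
  destruct (fpow'_bound k alpha) as [K [HK Hbound]]; [lra|].
  (* A primitive of the integrable majorant; being nonpositive with limit 0, it bounds the integral
     from [x] to any [y] by [- phi x], as Cauchy's criterion requires. *)
  set (phi := fun x => - (K / (alpha / 2)) * exp (- (alpha / 2 * ln x))).
  assert (Hinc : forall x y, 1 <= x -> x <= y -> Rabs (V y - V x) <= phi y - phi x).
  { intros x y Hx Hxy.
    apply (norm_RInt_le (V := R_NormedModule) (fun t => frac_part t * fpow' k alpha t)
             (fun t => K * exp (- ((1 + alpha / 2) * ln t))) x y).
    - assumption.
    - intros t Ht. change norm with Rabs. rewrite Rabs_mult.
      destruct (base_fp t) as [F1 F2].
      rewrite (Rabs_pos_eq (frac_part t)) by lra.
      eapply Rle_trans; [|apply Hbound; lra].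
      rewrite <- (Rmult_1_l (Rabs (fpow' k alpha t))) at 2.
      apply Rmult_le_compat_r; [apply Rabs_pos | lra].
    - evar_last.
      + apply (is_RInt_Chasles (V := R_NormedModule)) with 1.
        * apply (is_RInt_swap (V := R_NormedModule)), HV, Hx.
        * apply HV; lra.
      + unfold plus, opp; simpl; ring.
    - apply (is_RInt_derive phi).
      + intros t Ht. rewrite Rmin_left, Rmax_right in Ht by lra.
        unfold phi. auto_derive; [lra|].
        replace (- ((1 + alpha / 2) * ln t)) with (- (alpha / 2 * ln t) + - ln t) by ring.
        rewrite exp_plus, (exp_Ropp (ln t)), exp_ln by lra. field. lra.
      + intros t Ht. rewrite Rmin_left, Rmax_right in Ht by lra.
        apply (ex_derive_continuous (K := R_AbsRing) (V := R_NormedModule)). auto_derive. lra. }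
  assert (Hlim : is_lim phi p_infty 0).
  { evar_last.
    - apply is_lim_scal_l, (is_lim_exp_ln (alpha / 2)); lra.
    - simpl; f_equal; ring. }
  apply (filterlim_locally_cauchy (U := R_CompleteSpace) (F := Rbar_locally p_infty) V).
  intros eps. apply is_lim_spec in Hlim.
  exists (fun x => 1 <= x /\ Rabs (phi x - 0) < eps). split.
  { apply filter_and; [|apply Hlim]. exists 1; intros; lra. }
  assert (Hle : forall x y, 1 <= x -> x <= y -> Rabs (phi x - 0) < eps -> Rabs (V y - V x) < eps).
  { intros x y Hx Hxy He. eapply Rle_lt_trans; [apply Hinc; assumption|].
    assert (phi y <= 0).
    { unfold phi. assert (0 <= K / (alpha / 2)) by (apply Rmult_le_pos; [lra | apply Rlt_le, Rinv_0_lt_compat; lra]).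
      pose proof (Rmult_le_pos _ _ H (Rlt_le _ _ (exp_pos (- (alpha / 2 * ln y))))). lra. }
    apply Rabs_lt_between in He. lra. }
  intros u v [Hu1 Hu2] [Hv1 Hv2]. change (Rabs (V v - V u) < eps).
  destruct (Rle_lt_dec u v).
  - apply Hle; assumption.
  - rewrite Rabs_minus_sym. apply Hle; lra.
Qed.

(** Euler's formula is solved for the sum. The boundary term at [x] vanishes in the limit because
    [fpow] tends to 0, and the integral and the two values at 1 are the three terms of [H_k]. *)
Lemma is_lim_power_sum (k : nat) (alpha : R) : 0 < alpha < 1 ->
  is_lim (fun x => power_sum k alpha (floor_nat x) - I_k k x alpha) p_infty (H_k k alpha).
Proof.
  intros Ha. destruct (euler_integral_lim k alpha Ha) as [L HL].
  assert (HRInt : RInt_gen (fun t => frac_part t * fpow' k alpha t) (at_point 1) (Rbar_locally p_infty) = L).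
  { apply is_RInt_gen_unique. intros P HP.
    apply HL in HP.
    exists (fun a => a = 1) (fun x => 1 <= x /\ P (euler_integral k alpha (floor_nat x) x)).
    - reflexivity.
    - apply filter_and; [|exact HP]. exists 1; intros; lra.
    - intros a x -> [Hx HPx]. simpl. eexists; split; [|exact HPx].
      destruct (floor_nat_spec x Hx) as [n [Hn Hb]]. rewrite Hn.
      apply is_RInt_euler; [lra | assumption]. }
  assert (Hsmall : is_lim (fun x => (x - INR (floor_nat x)) * fpow k alpha x) p_infty 0).
  { destruct (fpow_bound k alpha) as [K [HK Hb]]; [lra|].
    apply (is_lim_le_le_loc (fun _ => 0) (fun x => K * exp (- (alpha / 2 * ln x)))).
    - exists 1. intros x Hx. specialize (Hb x (Rlt_le _ _ Hx)).
      destruct (floor_nat_spec x (Rlt_le _ _ Hx)) as [n [Hn Hx']]. rewrite Hn.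
      split.
      + apply Rmult_le_pos; lra.
      + apply Rle_trans with (1 * fpow k alpha x); [apply Rmult_le_compat_r; lra | lra].
    - apply is_lim_const.
    - evar_last.
      + apply is_lim_scal_l, (is_lim_exp_ln (alpha / 2)); lra.
      + simpl; f_equal; ring. }
  apply (is_lim_ext (fun x => (euler_integral k alpha (floor_nat x) x - (x - INR (floor_nat x)) * fpow k alpha x)
                              + (fpow k alpha 1 - I_k k 1 alpha))).
  { intros x. unfold euler_integral. ring. }
  evar_last.
  - apply is_lim_plus'; [apply is_lim_minus'; [exact HL | exact Hsmall] | apply is_lim_const].
  - unfold H_k. f_equal.
    change (RInt_gen _ (at_point 1) (Rbar_locally p_infty)) with
      (RInt_gen (fun t => frac_part t * fpow' k alpha t) (at_point 1) (Rbar_locally p_infty)).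
    rewrite HRInt, fpow_at_1, I_k_at_1 by lra.
    rewrite (pow_add (-1)), pow_1. unfold Rdiv. ring.
Qed.

(** * Decomposition of the progression sum *)

Definition twisted_sum (k : nat) (alpha y : R) (n : nat) : C :=
  sum_n_m (fun i => ee (INR i * y) * RtoC (fpow k alpha (INR i)))%C 1 n.

Lemma Cexp_RtoC (x : R) : Cexp (RtoC x) = RtoC (exp x).
Proof.
  unfold Cexp, RtoC; simpl. rewrite cos_0, sin_0. f_equal; ring.
Qed.

(** Each derivative in [s] brings down [- ln u]; this is the origin of the sign in the theorem. *)
Lemma dterm_fpow (k : nat) (alpha u : R) : 0 < u ->
  dterm k (RtoC alpha) (ln u) = RtoC ((-1) ^ k * fpow k alpha u).
Proof.
  intros Hu. unfold dterm, fpow, Rpower.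
  rewrite <- RtoC_opp, <- RtoC_mult, Cexp_RtoC, <- RtoC_mult. f_equal.
  replace (- alpha * ln u) with (- (alpha * ln u)) by ring.
  replace (- ln u) with (-1 * ln u) by ring.
  rewrite exp_Ropp, Rpow_mult_distr. unfold Rdiv; ring.
Qed.

Lemma pow_opp1_sqr (k : nat) : (-1) ^ k * (-1) ^ k = 1.
Proof. rewrite <- Rpow_mult_distr. replace (-1 * -1) with 1 by ring. apply pow1. Qed.

(** The sums run to [S n] because they are the partial sums of a series indexed from 0. The sign
    [(-1) ^ k] is its own inverse, so it can stand beside the derivative. *)
Lemma twisted_sum_lim (k : nat) (alpha y : R) : 0 < alpha -> 0 < y < 1 ->
  filterlim (fun n => twisted_sum k alpha y (S n)) eventually
    (locally (T := C_NormedModule)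
      (RtoC ((-1) ^ k) * complex_derive_n k (periodic_zeta y) (RtoC alpha))%C).
Proof.
  intros Ha Hy. rewrite complex_derive_n_periodic_zeta by assumption.
  destruct (ee_partial_sums_bounded y Hy) as [M HM].
  apply (filterlim_ext (sum_n (fun n => (ee (INR (S n) * y) * RtoC (fpow k alpha (INR (S n))))%C))).
  { intros n. unfold twisted_sum. rewrite <- sum_n_m_S. reflexivity. }
  apply (is_series_ext (K := C_AbsRing) (V := C_NormedModule)
    (fun n => scal (RtoC ((-1) ^ k)) (dirichlet_term (fun m => ee (INR (S m) * y)) k (RtoC alpha) n))).
  - intros n. unfold dirichlet_term. rewrite dterm_fpow by (apply lt_0_INR; lia).
    change (RtoC ((-1) ^ k) * (ee (INR (S n) * y) * RtoC ((-1) ^ k * fpow k alpha (INR (S n))))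
            = ee (INR (S n) * y) * RtoC (fpow k alpha (INR (S n))))%C.
    replace (fpow k alpha (INR (S n))) with ((-1) ^ k * (-1) ^ k * fpow k alpha (INR (S n))) at 2
      by (rewrite pow_opp1_sqr; ring).
    rewrite !RtoC_mult. ring.
  - apply (is_series_scal (K := C_AbsRing) (V := C_NormedModule)).
    now apply (dirichlet_sum_correct _ M).
Qed.

(** The range starts at 1 because frequency 0 carries [power_sum], which has no finite limit and is
    treated apart. *)
Lemma filterlim_sum_n_m (u : nat -> nat -> C) (l : nat -> C) (n : nat) :
  (forall a, (1 <= a <= n)%nat -> filterlim (u a) eventually (locally (T := C_NormedModule) (l a))) ->
  filterlim (fun N => sum_n_m (fun a => u a N) 1 n) eventually
    (locally (T := C_NormedModule) (sum_n_m l 1 n)).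
Proof.
  induction n as [|n IH]; intros H.
  - rewrite (sum_n_m_zero l) by lia.
    apply (filterlim_ext (fun _ => zero)).
    + intros N. rewrite sum_n_m_zero by lia. reflexivity.
    + apply filterlim_const.
  - rewrite sum_n_Sm by lia.
    apply (filterlim_ext (fun N => plus (sum_n_m (fun a => u a N) 1 n) (u (S n) N))).
    + intros N. rewrite sum_n_Sm by lia. reflexivity.
    + apply (filterlim_comp_2 (G := locally (T := C_NormedModule) (sum_n_m l 1 n))
               (H := locally (T := C_NormedModule) (l (S n)))).
      * apply IH. intros a Ha. apply H; lia.
      * apply H; lia.
      * apply (filterlim_plus (K := C_AbsRing) (V := C_NormedModule)).
Qed.

Lemma filterlim_Re_Im (u : nat -> C) (l : C) :
  filterlim u eventually (locally (T := C_NormedModule) l) ->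
  is_lim_seq (fun n => Re (u n)) (Re l) /\ is_lim_seq (fun n => Im (u n)) (Im l).
Proof.
  intros H. split; apply is_lim_seq_spec; intros eps;
    destruct (H _ (locally_ball (T := C_NormedModule) l eps)) as [N HN];
    exists N; intros n Hn; apply (HN n Hn).
Qed.

(** Induction on [n]: every new integer contributes its [fpow] times one instance of
    [roots_of_unity_sum]. The identity is finite, so the frequencies are separated before any limit
    is taken. *)
Lemma progression_sum_twisted (k : nat) (alpha : R) (b q n : nat) :
  (1 <= q)%nat -> (b <= q)%nat ->
  RtoC (INR q * sum_n_m (fun i => if Nat.eqb (i mod q) (b mod q)
                                  then fpow k alpha (INR i) else 0) 1 n)
  = sum_n_m (fun a => ee (- (INR a * (INR b / INR q))) *
                      twisted_sum k alpha (INR a / INR q) n)%C 0 (q - 1).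
Proof.
  intros Hq Hb. induction n as [|n IH].
  - rewrite sum_n_m_zero by lia.
    rewrite (sum_n_m_ext _ (fun _ => zero)).
    + rewrite sum_n_m_const_zero. change zero with 0 at 1. rewrite Rmult_0_r. reflexivity.
    + intros a. unfold twisted_sum. rewrite sum_n_m_zero by lia. apply Cmult_0_r.
  - rewrite (sum_n_Sm _ 1 n) by lia. change plus with Rplus.
    rewrite Rmult_plus_distr_l, RtoC_plus, IH.
    rewrite (sum_n_m_ext (fun a => ee (- (INR a * (INR b / INR q))) * twisted_sum k alpha (INR a / INR q) (S n))%C
      (fun a => plus (ee (- (INR a * (INR b / INR q))) * twisted_sum k alpha (INR a / INR q) n)%C
         (mult (K := C_Ring) (ee (INR a * (INR (S n) / INR q)) * ee (- (INR a * (INR b / INR q))))%C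
            (RtoC (fpow k alpha (INR (S n))))))).
    + rewrite sum_n_m_plus, (sum_n_m_mult_r (K := C_Ring)).
      pose proof (roots_of_unity_sum (S n) b q Hq Hb) as Hr. unfold sum_n in Hr.
      match goal with |- (?x + _)%C = plus ?x (mult ?s _) =>
        replace s with (RtoC (if Nat.eqb (S n mod q) (b mod q) then INR q else 0)) end.
      change plus with Cplus. change mult with Cmult. rewrite <- RtoC_mult. do 2 f_equal.
      destruct (Nat.eqb _ _); ring.
    + intros a. unfold twisted_sum at 1. rewrite sum_n_Sm by lia.
      change plus with Cplus. change mult with Cmult.
      replace (INR (S n) * (INR a / INR q)) with (INR a * (INR (S n) / INR q)) by (unfold Rdiv; ring).
      fold (twisted_sum k alpha (INR a / INR q) n). C_ring.
Qed.

Lemma filterlim_floor_nat : filterlim floor_nat (Rbar_locally p_infty) eventually.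
Proof.
  intros P [N HN]. exists (INR N + 1). intros x Hx. apply HN.
  pose proof (pos_INR N).
  destruct (floor_nat_spec x) as [n [Hn Hb]]; [lra|]. rewrite Hn.
  apply INR_le. lra.
Qed.

Lemma Cexp_fraction (a b q : nat) : (1 <= q)%nat ->
  Cexp (- (2 * PI * Ci * INR a * INR b / INR q)) = ee (- (INR a * (INR b / INR q))).
Proof.
  intros Hq. assert (INR q <> 0) by (apply not_0_INR; lia).
  unfold ee. f_equal. unfold Rdiv.
  rewrite RtoC_opp, !RtoC_mult, RtoC_inv by assumption. unfold Cdiv. ring.
Qed.

Lemma twisted_sum_0 (k : nat) (alpha : R) (n : nat) :
  twisted_sum k alpha 0 n = RtoC (power_sum k alpha n).
Proof.
  unfold twisted_sum, power_sum. induction n as [|n IH].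
  - rewrite !sum_n_m_zero by lia. reflexivity.
  - rewrite !sum_n_Sm, IH by lia. rewrite Rmult_0_r, ee_0, Cmult_1_l.
    change plus with Rplus at 2. rewrite RtoC_plus. reflexivity.
Qed.

Theorem theorem1 :
  forall (alpha : R) (k b q : nat),
    0 < alpha < 1 ->
    (1 <= b)%nat -> (1 <= q)%nat -> (b <= q)%nat ->
    RtoC (shifted_euler_constant k alpha b q) =
    (RtoC (H_k k alpha / INR q)
     + RtoC ((-1) ^ k / INR q) *
       sum_n_m (fun a : nat =>
                  complex_derive_n k (periodic_zeta (INR a / INR q)) (RtoC alpha)
                  * Cexp (- (2 * PI * Ci * INR a * INR b / INR q)))
               1 (q - 1))%C.
Proof.
  intros alpha k b q Ha _ Hq Hb.
  assert (Hq0 : 0 < INR q) by (apply lt_0_INR; lia).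
  set (P := fun n => sum_n_m (fun i => if Nat.eqb (i mod q) (b mod q)
                                  then fpow k alpha (INR i) else 0) 1 n).
  (* The contribution of the nonzero frequencies: the divergent [a = 0] part is subtracted. *)
  set (d := fun n => INR q * P n - power_sum k alpha n).
  set (W := fun n => sum_n_m (fun a => ee (- (INR a * (INR b / INR q))) *
                      twisted_sum k alpha (INR a / INR q) (S n))%C 1 (q - 1) : C).
  set (F := fun a => complex_derive_n k (periodic_zeta (INR a / INR q)) (RtoC alpha)).
  set (l := sum_n_m (fun a => (ee (- (INR a * (INR b / INR q))) * (RtoC ((-1) ^ k) * F a))%C) 1 (q - 1)).
  assert (HW : forall n, W n = RtoC (d (S n))).
  { intros n. unfold d. rewrite RtoC_minus. unfold P.
    rewrite progression_sum_twisted, sum_Sn_m by lia.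
    change plus with Cplus. fold (W n).
    replace (INR 0 / INR q) with 0 by (simpl; unfold Rdiv; ring).
    replace (- (INR 0 * (INR b / INR q))) with 0 by (simpl; ring).
    rewrite twisted_sum_0, ee_0. C_ring. }
  assert (Hlim : filterlim W eventually (locally (T := C_NormedModule) l)).
  { apply (filterlim_sum_n_m (fun a n => ee (- (INR a * (INR b / INR q))) *
             twisted_sum k alpha (INR a / INR q) (S n))%C).
    intros a Hab.
    apply (filterlim_comp _ _ _ (fun n => twisted_sum k alpha (INR a / INR q) (S n))
             (scal (V := C_NormedModule) (ee (- (INR a * (INR b / INR q))))) eventually
             (locally (T := C_NormedModule) (RtoC ((-1) ^ k) * F a)%C)).
    - apply twisted_sum_lim; [lra|]. split.
      + apply Rdiv_lt_0_compat; [apply lt_0_INR; lia | assumption].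
      + apply Rmult_lt_reg_r with (INR q); [assumption|].
        replace (INR a / INR q * INR q) with (INR a) by (field; lra).
        rewrite Rmult_1_l. apply lt_INR; lia.
    - apply (filterlim_scal_r (K := C_AbsRing) (V := C_NormedModule)). }
  destruct (filterlim_Re_Im W l Hlim) as [HRe HIm].
  (* The single twisted sums are complex, but their combination is the real number [d (S n)], so the
     imaginary part of the limit vanishes. *)
  assert (Hl : l = RtoC (Re l)).
  { destruct l as [x y]. unfold RtoC. simpl in *. f_equal.
    apply is_lim_seq_unique in HIm.
    rewrite (Lim_seq_ext _ (fun _ => 0)), Lim_seq_const in HIm.
    - congruence.
    - intros n. rewrite HW. reflexivity. }
  assert (Hd : is_lim_seq d (Re l)).
  { apply is_lim_seq_incr_1. revert HRe. apply is_lim_seq_ext.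
    intros n. rewrite HW. reflexivity. }
  (* Only the frequency 0 needs the correction [I_k]; [d] converges by itself, as a sequence, and is
     composed with the floor. *)
  assert (Hconst : is_lim (fun x => progression_sum k alpha b q x - I_k k x alpha / INR q) p_infty
                     ((H_k k alpha + Re l) / INR q)).
  { apply (is_lim_ext (fun x => ((power_sum k alpha (floor_nat x) - I_k k x alpha) + d (floor_nat x)) * / INR q)).
    - intros x. unfold d, P. change (progression_sum k alpha b q x) with (P (floor_nat x)).
      unfold P. field. lra.
    - apply (is_lim_scal_r _ (/ INR q) p_infty (H_k k alpha + Re l)).
      apply is_lim_plus'; [now apply is_lim_power_sum|].
      exact (filterlim_comp _ _ _ floor_nat d _ _ _ filterlim_floor_nat Hd). }
  assert (Heq : shifted_euler_constant k alpha b q = (H_k k alpha + Re l) / INR q).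
  { apply (iota_unique (V := R_CompleteNormedModule)); [|exact Hconst].
    intros y Hy. apply is_lim_unique in Hy. apply is_lim_unique in Hconst. congruence. }
  rewrite Heq. unfold Rdiv at 1. rewrite Rmult_plus_distr_r, RtoC_plus, (RtoC_mult (Re l)), <- Hl.
  unfold Rdiv at 1. f_equal.
  rewrite (sum_n_m_ext _ (fun a => F a * ee (- (INR a * (INR b / INR q))))%C).
  2:{ intros a. rewrite Cexp_fraction by assumption. reflexivity. }
  unfold Rdiv at 1. rewrite RtoC_mult.
  unfold l. rewrite (sum_n_m_ext _ (fun a => mult (K := C_Ring) (RtoC ((-1) ^ k)) (F a * ee (- (INR a * (INR b / INR q))))%C)).
  2:{ intros a. change mult with Cmult. C_ring. }
  rewrite (sum_n_m_mult_l (K := C_Ring)).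
  match goal with |- (mult ?z ?s * ?r = _)%C => change (z * s * r = z * r * s)%C end.
  ring.
Qed.
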